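(* Let $T\in\mathbb{R}_+^{N_1\times\cdots\times N_m}$ be an entrywise nonnegative tensor, $\boldsymbol{\sigma}=\{\sigma_i\}_{i=1}^d$ a shape partition of $T$ and $p=(p_1,\ldots,p_d)\in(1,\infty)^d$. Let $r=r^{(\boldsymbol{\sigma},p)}(T)$, $F=F^{(\boldsymbol{\sigma},p)}$, $A=A(\boldsymbol{\sigma},p)$ and $b$ be as defined in the context. Suppose that $T$ is $\boldsymbol{\sigma}$-strictly nonnegative and $\rho(A)\le1$. Then: (i) There exists a $(\boldsymbol{\sigma},p)$-eigenpair $(\lambda,u)\in\mathbb{R}_+\times\mathcal{K}_{+,0}$ of $T$ such that $\lambda=r$. (ii) Let $\gamma=\frac{\sum_{i=1}^d b_ip_i'}{\sum_{i=1}^d b_ip_i'-1}$. Then $\gamma\in(1,\infty)$ and $$\inf_{x\in\mathcal{S}_{++}}\overline{\mathrm{cw}}(F,x)=r=\max_{y\in\mathcal{S}_+}\underline{\mathrm{cw}}(F,y),$$ where $$\overline{\mathrm{cw}}(F,x)=\prod_{i=1}^d\Big(\max_{j_i\in[n_i]}\frac{F_{i,j_i}(x)}{x_{i,j_i}}\Big)^{(\gamma-1)b_i},\qquad \underline{\mathrm{cw}}(F,y)=\prod_{i=1}^d\Big(\min_{j_i\in[n_i],\,y_{i,j_i}>0}\frac{F_{i,j_i}(y)}{y_{i,j_i}}\Big)^{(\gamma-1)b_i}.$$ If additionally $\rho(A)=1$, then $$r=\sup_{z\in\mathcal{K}_{+,0}}\limsup_{k\to\infty}\Big(\prod_{i=1}^d\|(F^k)_i(z)\|_{p_i}^{b_i}\Big)^{\frac{\gamma-1}{k}}=\lim_{k\to\infty}\Big(\sup_{z\in\mathcal{S}_+}\prod_{i=1}^d\|(F^k)_i(z)\|_{p_i}^{b_i}\Big)^{\frac{\gamma-1}{k}},$$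 where $F^k=((F^k)_1,\ldots,(F^k)_d)$ is the $k$-fold composition of $F$ with itself. (iii) If either $\rho(A)<1$ or $T$ is $\boldsymbol{\sigma}$-weakly irreducible, then the $(\boldsymbol{\sigma},p)$-eigenvector $u$ of (i) can be chosen strictly positive, i.e. $u\in\mathcal{K}_{++}$. Moreover, $u$ is then the unique positive $(\boldsymbol{\sigma},p)$-eigenvector of $T$. (iv) If $T$ is $\boldsymbol{\sigma}$-weakly irreducible, then every $(\boldsymbol{\sigma},p)$-eigenpair $(\vartheta,x)$ of $T$ with $x\in\mathcal{K}_{+,0}\setminus\mathcal{K}_{++}$ satisfies $\vartheta<r$. (v) If $T$ is $\boldsymbol{\sigma}$-strongly irreducible, then the $(\boldsymbol{\sigma},p)$-eigenvector $u$ of (i) is positive and it is the unique nonnegative $(\boldsymbol{\sigma},p)$-eigenvector of $T$.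
   Context: Write $[N]=\{1,\ldots,N\}$ and $\mathbb{R}_+=[0,\infty)$. For a tensor $T\in\mathbb{R}^{N_1\times\cdots\times N_m}$ let $f_T(z_1,\ldots,z_m)=\sum_{j_1\in[N_1],\ldots,j_m\in[N_m]}T_{j_1,\ldots,j_m}z_{1,j_1}\cdots z_{m,j_m}$ for $z_i\in\mathbb{R}^{N_i}$, and let $\mathcal{T}_{i,j_i}(z_1,\ldots,z_m)=\partial f_T/\partial z_{i,j_i}$, $\mathcal{T}_i=(\mathcal{T}_{i,1},\ldots,\mathcal{T}_{i,N_i})$. Shape partition: $\boldsymbol{\sigma}=\{\sigma_i\}_{i=1}^d$ is a shape partition of $T$ if it is a partition of $[m]$ into nonempty sets such that $N_j=N_{j'}$ whenever $j,j'\in\sigma_i$ for some $i$, and moreover (a) for every $i\in[d-1]$, $j\in\sigma_i$, $k\in\sigma_{i+1}$ one has $j\le k$; (b) if $d>1$, $|\sigma_i|\le|\sigma_{i+1}|$ for every $i\in[d-1]$. Put $\nu_i=|\sigma_i|$, $s_i=\min\sigma_i$, $n_i=N_{s_i}$. For $x=(x_1,\ldots,x_d)\in\mathbb{R}^{n_1}\times\cdots\times\mathbb{R}^{n_d}$ let $x^{[\boldsymbol{\sigma}]}=(x_1,\ldots,x_1,\ldots,x_d,\ldots,x_d)$ with $x_i$ repeated $\nu_i$ times. Let $\mathcal{I}^{\boldsymbol{\sigma}}=\bigcup_{i=1}^d\{i\}\times[n_i]$. Cones and spheres: $\mathcal{K}_+=\mathbb{R}_+^{n_1}\times\cdots\times\mathbb{R}_+^{n_d}$,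 $\mathcal{K}_{+,0}=\{x\in\mathcal{K}_+: x_i\ne0\ \forall i\in[d]\}$, $\mathcal{K}_{++}$ is the interior of $\mathcal{K}_+$, $\mathcal{S}_+=\{x\in\mathcal{K}_+:\|x_i\|_{p_i}=1\ \forall i\in[d]\}$, $\mathcal{S}_{++}=\mathcal{S}_+\cap\mathcal{K}_{++}$. A vector is called nonnegative (positive) if it lies in $\mathcal{K}_+$ ($\mathcal{K}_{++}$). Eigenpairs: $(\lambda,x)\in\mathbb{R}\times(\mathbb{R}^{n_1}\times\cdots\times\mathbb{R}^{n_d})$ is a $(\boldsymbol{\sigma},p)$-eigenpair of $T$ (with $\lambda$ a $(\boldsymbol{\sigma},p)$-eigenvalue and $x$ a $(\boldsymbol{\sigma},p)$-eigenvector) if $\mathcal{T}_{s_i}(x^{[\boldsymbol{\sigma}]})=\lambda\psi_{p_i}(x_i)$ and $\|x_i\|_{p_i}=1$ for all $i\in[d]$, where $\psi_{q}(v)$ has entries $|v_j|^{q-1}\mathrm{sign}(v_j)$, $\mathrm{sign}(0)=0$. The $(\boldsymbol{\sigma},p)$-spectral radius is $r^{(\boldsymbol{\sigma},p)}(T)=\sup\{|\lambda|:\lambda\text{ is a }(\boldsymbol{\sigma},p)\text{-eigenvalue of }T\}$. The map $F^{(\boldsymbol{\sigma},p)}:\mathcal{K}_+\to\mathcal{K}_+$ has components $F_{i,j_i}(x)=\big(\mathcal{T}_{s_i,j_i}(x^{[\boldsymbol{\sigma}]})\big)^{p_i'-1}$, $(i,j_i)\in\mathcal{I}^{\boldsymbol{\sigma}}$,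 with $p_i'=p_i/(p_i-1)$, and $F_i=(F_{i,1},\ldots,F_{i,n_i})$. Its homogeneity matrix is $A(\boldsymbol{\sigma},p)=\mathrm{diag}(p_1'-1,\ldots,p_d'-1)(\mathbf{1}\nu^\top-I)\in\mathbb{R}_+^{d\times d}$, where $\nu=(\nu_1,\ldots,\nu_d)^\top$ and $\mathbf{1}$ is the all-ones vector; $\rho(A)$ is its spectral radius, and $b\in\mathbb{R}^d$ is the unique entrywise positive vector with $A^\top b=\rho(A)b$ and $\sum_{i=1}^d b_i=1$. Irreducibility classes: let $M$ be the square matrix indexed by $\mathcal{I}^{\boldsymbol{\sigma}}$ with $M_{(i,t_i),(k,l_k)}=\frac{\partial}{\partial x_{k,l_k}}\mathcal{T}_{s_i,t_i}(x^{[\boldsymbol{\sigma}]})\big|_{x=\mathbf{1}}$. $T$ is $\boldsymbol{\sigma}$-strictly nonnegative if $M$ has at least one nonzero entry in each row; $\boldsymbol{\sigma}$-weakly irreducible if $M$ is irreducible; $\boldsymbol{\sigma}$-strongly irreducible if for every $x\in\mathcal{K}_{+,0}\setminus\mathcal{K}_{++}$ there exists $(k,l_k)\in\mathcal{I}^{\boldsymbol{\sigma}}$ with $x_{k,l_k}=0$ and $\mathcal{T}_{s_k,l_k}(x^{[\boldsymbol{\sigma}]})>0$. *)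

(* Defs.v *)
From HB Require Import structures.
From mathcomp Require Import all_boot all_order all_algebra.
From mathcomp Require Import complex.
From mathcomp Require Import all_classical all_reals all_analysis.

Set Implicit Arguments.
Unset Strict Implicit.
Unset Printing Implicit Defensive.

Import Order.TTheory GRing.Theory Num.Theory.
Import numFieldNormedType.Exports.

Local Open Scope classical_set_scope.
Local Open Scope ring_scope.

Section BlockVectors.
Context {R : realType} {d : nat} {n : 'I_d -> nat}.

Definition blockvec := forall i : 'I_d, 'rV[R]_(n i).

(* The index set I^sigma, i.e. the disjoint union of the [n_i]. *)
Definition bindex := {i : 'I_d & 'I_(n i)}.

Definition entry (x : blockvec) (a : bindex) : R := x (tag a) 0 (tagged a).

(* x with its entry (i, l) replaced by t *)
Definition set_entry (x : blockvec) (a : bindex) (t : R) : blockvec :=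
  dfwith x (tag a) (\row_l (if l == tagged a then t else x (tag a) 0 l)).

Definition partial (f : blockvec -> R) (a : bindex) (x : blockvec) : R :=
  derive1 (fun t : R => f (set_entry x a t)) (entry x a).

Definition onesv : blockvec := fun i => const_mx 1.

Definition lpnorm (q : R) (k : nat) (v : 'rV[R]_k) : R :=
  (\sum_(l < k) `|v 0 l| `^ q) `^ q^-1.

Definition Kp : set blockvec := [set x | forall a, 0 <= entry x a].

Definition Kp0 : set blockvec := Kp `&` [set x | forall i, x i != 0].

Definition Kpp : set blockvec :=
  interior (Kp : set (prod_topology (fun i => 'rV[R]_(n i)))).

Definition Sp (p : 'I_d -> R) : set blockvec :=
  Kp `&` [set x | forall i, lpnorm (p i) (x i) = 1].

Definition Spp (p : 'I_d -> R) : set blockvec := Sp p `&` Kpp.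

End BlockVectors.
Arguments blockvec R {d} n.
Arguments bindex {d} n.

Section Matrices.
Context {R : realType}.

Definition spectral_radius (d : nat) (A : 'M[R]_d) : R :=
  sup [set ComplexField.Normc.normc z | z in
    [set z : R[i] | eigenvalue (map_mx (real_complex R) A) z]].

(* A square matrix indexed by a finite type is irreducible if no simultaneous
   permutation of rows and columns makes it block triangular, with nonempty
   square diagonal blocks.  Every 1 x 1 matrix is irreducible. *)
Definition irreducible_matrix (I : finType) (M : I -> I -> R) : Prop :=
  forall J : {set I}, J != finset.set0 -> J != [set: I]%SET ->
    exists a b, [/\ a \in J, b \notin J & M a b != 0].

End Matrices.

(* Positions of the tensor and blocks are numbered from 0. *)
Record shape_partition (m : nat) (N : 'I_m -> nat) (d : nat) := ShapePartition {
  block :> 'I_d -> {set 'I_m} ;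
  block_inj : injective block ;
  block_partition :
    finset.partition [set block i | i : 'I_d]%SET [set: 'I_m]%SET ;
  block_dim : forall i j j', j \in block i -> j' \in block i -> N j = N j' ;
  block_le : forall i i' : 'I_d, i' = i.+1 :> nat ->
    forall j k, j \in block i -> k \in block i' -> (j <= k)%N ;
  block_card : forall i i' : 'I_d, i' = i.+1 :> nat ->
    (#|block i| <= #|block i'|)%N
}.

Section Shape.
Context {m : nat} {N : 'I_m -> nat} {d : nat} (sigma : shape_partition N d).

Lemma block_neq0 i : sigma i != finset.set0.
Proof.
have /and3P[_ _] := block_partition sigma.
apply: contraNneq => <-; exact: imset_f.
Qed.

Lemma block_nonempty i : exists j, j \in sigma i.
Proof. exact/set0Pn/block_neq0. Qed.

Definition nu (i : 'I_d) : nat := #|sigma i|.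

(* s_i = min sigma_i *)
Definition smin (i : 'I_d) : 'I_m :=
  [arg min_(j < xchoose (block_nonempty i) in sigma i) (j : nat)]%N.

Lemma smin_in i : smin i \in sigma i.
Proof.
by rewrite /smin; case: arg_minnP => //; exact: xchooseP (block_nonempty i).
Qed.

Definition bdim (i : 'I_d) : nat := N (smin i).

Lemma block_exists (j : 'I_m) : exists i, j \in sigma i.
Proof.
have /and3P[/eqP cov _ _] := block_partition sigma.
have : j \in [set: 'I_m]%SET by rewrite inE.
rewrite -cov => /bigcupP[B /imsetP[i _ ->] ji]; by exists i.
Qed.

Definition block_of (j : 'I_m) : 'I_d := xchoose (block_exists j).

Lemma block_ofP j : j \in sigma (block_of j).
Proof. exact: (xchooseP (block_exists j)). Qed.

Lemma bdim_block_of j : bdim (block_of j) = N j.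
Proof. exact: block_dim (smin_in _) (block_ofP j). Qed.

(* x^[sigma]: the j-th component is x_i for the block sigma_i containing j.
   As the blocks are consecutive intervals, this is
   (x_1, .., x_1, .., x_d, .., x_d) with x_i repeated nu_i times. *)
Definition expand {R : realType} (x : blockvec R bdim) : blockvec R N :=
  fun j => castmx (erefl, bdim_block_of j) (x (block_of j)).

End Shape.

Section Tensors.
Context {R : realType} {m : nat} {N : 'I_m -> nat}.

Definition tensor := {dffun forall j : 'I_m, 'I_(N j)} -> R.

Definition tform (T : tensor) (z : blockvec R N) : R :=
  \sum_(J : {dffun forall j : 'I_m, 'I_(N j)}) T J * \prod_(j < m) z j 0 (J j).

Definition tgrad (T : tensor) (a : bindex N) (z : blockvec R N) : R :=
  partial (tform T) a z.

Context {d : nat} (sigma : shape_partition N d).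
Local Notation n := (bdim sigma).

(* T_{s_i,l}(x^[sigma]) *)
Definition sgrad (T : tensor) (a : bindex n) (x : blockvec R n) : R :=
  tgrad T (Tagged (fun j => 'I_(N j)) (tagged a : 'I_(N (smin sigma (tag a)))))
    (expand x).

Definition bi (i : 'I_d) (l : 'I_(n i)) : bindex n :=
  Tagged (fun i => 'I_(n i)) l.

Definition Mmatrix (T : tensor) (a c : bindex n) : R :=
  partial (sgrad T a) c onesv.

Definition strictly_nonneg (T : tensor) : Prop :=
  forall a, exists c, Mmatrix T a c != 0.

Definition weakly_irreducible (T : tensor) : Prop :=
  irreducible_matrix (Mmatrix T).

Definition strongly_irreducible (T : tensor) : Prop :=
  forall x : blockvec R n, (Kp0 `\` Kpp) x ->
    exists a : bindex n, entry x a = 0 /\ 0 < sgrad T a x.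

Context (p : 'I_d -> R).

Definition psi (q t : R) : R := `|t| `^ (q - 1) * Num.sg t.

Definition eigenpair (T : tensor) (lambda : R) (x : blockvec R n) : Prop :=
  (forall i (l : 'I_(n i)), sgrad T (bi l) x = lambda * psi (p i) (x i 0 l)) /\
  (forall i, lpnorm (p i) (x i) = 1).

(* Extended-real valued, so that the supremum is meaningful without knowing
   that the set of eigenvalues is nonempty and bounded. *)
Definition tensor_radius (T : tensor) : \bar R :=
  ereal_sup [set `|lambda|%:E | lambda in
    [set lambda : R | exists x, eigenpair T lambda x]].

Definition conjexp (q : R) : R := q / (q - 1).

Definition Fmap (T : tensor) (x : blockvec R n) : blockvec R n :=
  fun i => \row_l (sgrad T (bi l) x) `^ (conjexp (p i) - 1).

Definition Amatrix : 'M[R]_d :=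
  diag_mx (\row_i (conjexp (p i) - 1)) *m
  ((const_mx 1 : 'cV[R]_d) *m (\row_i (nu sigma i)%:R) - 1%:M).

Definition is_weight (b : 'cV[R]_d) : Prop :=
  [/\ forall i, 0 < b i 0,
      Amatrix^T *m b = spectral_radius Amatrix *: b
    & \sum_(i < d) b i 0 = 1].

(* The vector b: definite description of the unique b with is_weight b. *)
Definition bweight : 'cV[R]_d := xget 0 [set b | is_weight b].

Definition gexp : R :=
  let s := \sum_(i < d) bweight i 0 * conjexp (p i) in s / (s - 1).

(* The sup and inf range over finite sets (nonempty where these functions are
   used), so they are a maximum and a minimum. *)
Definition cw_upper (F : blockvec R n -> blockvec R n) (x : blockvec R n) : R :=
  \prod_(i < d) sup [set F x i 0 l / x i 0 l | l in [set: 'I_(n i)]]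
    `^ ((gexp - 1) * bweight i 0).

Definition cw_lower (F : blockvec R n -> blockvec R n) (y : blockvec R n) : R :=
  \prod_(i < d) inf [set F y i 0 l / y i 0 l | l in [set l | 0 < y i 0 l]]
    `^ ((gexp - 1) * bweight i 0).

Definition wnorm (x : blockvec R n) : R :=
  \prod_(i < d) lpnorm (p i) (x i) `^ bweight i 0.

End Tensors.
Arguments tensor R {m} N.
Arguments eigenpair {R m N d} sigma p T lambda x.
Arguments tensor_radius {R m N d} sigma p T.
Arguments Fmap {R m N d} sigma p T x.
Arguments cw_upper {R m N d} sigma p F x.
Arguments cw_lower {R m N d} sigma p F y.
Arguments wnorm {R m N d} sigma p x.

(* Main.v *)
Require Import Defs.
From mathcomp Require Import all_boot all_order all_algebra.
From mathcomp Require Import complex.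
From mathcomp Require Import all_classical all_reals all_analysis.
From mathcomp Require Import lra ring.

Set Implicit Arguments.
Unset Strict Implicit.
Unset Printing Implicit Defensive.

Import Order.TTheory GRing.Theory Num.Theory.
Import numFieldNormedType.Exports.

Local Open Scope classical_set_scope.
Local Open Scope ring_scope.

(** The theorem is a nonlinear Perron-Frobenius theorem, and it rests on one
linear identity.  The map F is order preserving, and scaling block k of its
argument by exp (delta k), for all k, scales block i of its value by
exp ((A delta)_i).  Because b is a positive left eigenvector of A, the
b-weighted sum of A delta is rho(A) times the b-weighted sum of delta, and
rho(A) <= 1.

Comparison ([cw_le]).  Let x be positive and y nonnegative, both of norm one in
each block, and let delta be least with y <= exp delta x; then delta >= 0, and
in every block some index attains equality.  If F x <= B x and F y >= alpha y,
reading both inequalities at such an index gives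
alpha_i exp (delta_i) <= exp ((A delta)_i) B_i, and the weighted product over i
eliminates delta: the product of the alpha_i^(w_i) is at most that of the
B_i^(w_i), where w = (gamma - 1) b is the normalization of b for which the
Collatz-Wielandt number of an eigenvector is its eigenvalue.  Hence the lower
number of every vector, and, through y = |x|, the modulus of the eigenvalue of
every eigenvector x, lies below all upper numbers.

Existence ([nonneg_eigenpair_exists]).  It remains to find a nonnegative
eigenpair whose eigenvalue is approached by upper numbers.  If rho(A) < 1 and
A c = rho(A) c with c > 0, then F maps the order interval between exp (- L c)
and exp (L c) into itself for L large, and the infimum of the supersolutions in
it is a fixed point.  Normalizing its blocks gives an eigenvector; the
eigenvalues obtained in the different blocks agree, because each of them is the
value of the tensor form (Euler's identity [euler]).  If rho(A) = 1, the exponents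
p_i' - 1 are multiplied by t < 1, which replaces A by t A, and t tends to 1.

Positivity and uniqueness.  When M is irreducible, the ratios of the entries
inside one block of these eigenvectors are bounded uniformly in t
([ratio_bound]), so the limit is positive.  When two eigenvectors are compared,
equality must hold throughout the comparison; then delta = 0 if rho(A) < 1,
and otherwise the indices where y = exp delta x are closed under the dependency
relation of M ([rigidity]).  Strong irreducibility implies weak irreducibility
([strong_irreducible]).  For rho(A) = 1 the weighted sum of the logarithms
grows linearly along the orbits of F, which gives the two limit formulas
([growth_upper], [growth_eigen]).

The matrix A is explicit enough that its Perron theory is as well: rho(A) is
the root of sum_k q_k nu_k / (rho + q_k) = 1 with q_k = p_k' - 1, with left
eigenvector nu_k / (rho + q_k) and right eigenvector q_k / (rho + q_k)
([Amatrix_perron]). *)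

(** * Monotone multihomogeneous maps of a hypergraph *)

Lemma expR_ge1 (R : realType) (t : R) : (1 <= expR t) = (0 <= t).
Proof. by rewrite -{1}(@expR0 R) ler_expR. Qed.

(** The combinatorial content of a tensor with a shape partition: an entry e
of the tensor occupies an index pos e j in every position j, the index lies in
the block of the position, and slot i is the position in which the form is
differentiated to obtain block i of the gradient.  Forgetting the dependent
types of the positions makes all vectors plain functions on the set I of
indices. *)
Record system (R : realType) (D P I E : finType) := System {
  blk : P -> D ;
  slot : D -> P ;
  bid : I -> D ;
  pos : E -> P -> I ;
  wt : E -> R ;
  wt_ge0 : forall e, 0 <= wt e ;
  bid_pos : forall e j, bid (pos e j) = blk j ;
  blk_slot : forall i, blk (slot i) = i ;
  bid_surj : forall i, exists a, bid a = i
}.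

Section System.
Context {R : realType} {D P I E : finType} (S : system R D P I E).
Implicit Types (x y z : I -> R) (delta q w c : D -> R) (a : I) (i : D) (e : E).

Local Notation blk := (blk S).
Local Notation slot := (slot S).
Local Notation bid := (bid S).
Local Notation pos := (pos S).
Local Notation wt := (wt S).

Definition value x : R := \sum_e wt e * \prod_j x (pos e j).

Definition grad x a : R :=
  \sum_(e | pos e (slot (bid a)) == a)
     wt e * \prod_(j | j != slot (bid a)) x (pos e j).

(** The index a' occurs in some monomial of the a-th component of the gradient;
equivalently, the matrix M has a nonzero entry at (a, a'). *)
Definition edge a a' : Prop := exists e j,
  [/\ 0 < wt e, pos e (slot (bid a)) = a, j != slot (bid a) & pos e j = a'].

Definition serial : Prop := forall a, exists a', edge a a'.

Definition irreducible_system : Prop := forall J : {set I},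
  J != finset.set0 -> J != [set: I]%SET ->
  exists a a', [/\ a \in J, a' \notin J & edge a a'].

(** With q i = p_i' - 1, the number q i * rest delta i is the i-th component of
the homogeneity matrix applied to delta. *)
Definition rest delta i : R := \sum_(j | j != slot i) delta (blk j).

Definition scale delta x : I -> R := fun a => expR (delta (bid a)) * x a.

(** The exponents q i = p_i' - 1 are a parameter, because the limit argument
below lets them vary; p_i is recovered as 1 + (q i)^-1. *)
Definition Fq q x : I -> R := fun a => grad x a `^ q (bid a).

Definition normalized q x : Prop :=
  forall i, \sum_(a | bid a == i) x a `^ (1 + (q i)^-1) = 1.

Definition eigen q (lam : R) x : Prop :=
  (forall a, grad x a = lam * x a `^ (q (bid a))^-1) /\ normalized q x.

Lemma scale_gt0 delta x : (forall a, 0 < x a) -> forall a, 0 < scale delta x a.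
Proof. by move=> x0 a; rewrite mulr_gt0 // expR_gt0. Qed.

Lemma grad_ge0 x : (forall a, 0 <= x a) -> forall a, 0 <= grad x a.
Proof.
move=> x0 a; apply: sumr_ge0 => e _; rewrite mulr_ge0 ?wt_ge0 //.
exact: prodr_ge0.
Qed.

Lemma grad_scale delta x a :
  grad (scale delta x) a = expR (rest delta (bid a)) * grad x a.
Proof.
rewrite /grad mulr_sumr; apply: eq_bigr => e _.
rewrite big_split /= mulrCA; congr (_ * _); rewrite /rest expR_sum.
by apply: eq_bigr => j _; rewrite bid_pos.
Qed.

Lemma grad_le x y : (forall a, 0 <= x a) -> (forall a, x a <= y a) ->
  forall a, grad x a <= grad y a.
Proof.
move=> x0 xy a; apply: ler_sum => e _; rewrite ler_wpM2l ?wt_ge0 //.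
by apply: ler_prod => j _; rewrite x0 xy.
Qed.

Lemma prod_lt (Q : pred P) (f g : P -> R) j0 : Q j0 ->
  (forall j, 0 <= f j <= g j) -> (forall j, 0 < g j) -> f j0 < g j0 ->
  \prod_(j | Q j) f j < \prod_(j | Q j) g j.
Proof.
move=> Qj0 fg g0 lt0; rewrite (bigD1 j0) //= [ltRHS](bigD1 j0) //=.
apply: le_lt_trans (_ : f j0 * \prod_(i | Q i && (i != j0)) g i < _).
  by rewrite ler_wpM2l //; [case/andP: (fg j0) | exact: ler_prod].
by rewrite ltr_pM2r // prodr_gt0.
Qed.

Lemma grad_lt x y a a' : (forall a, 0 <= x a) -> (forall a, x a <= y a) ->
  (forall a, 0 < y a) -> edge a a' -> x a' < y a' -> grad x a < grad y a.
Proof.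
move=> x0 xy y0 [e [j [we ea ja ja']]] lt.
rewrite /grad (bigD1 e) /= ?ea // [ltRHS](bigD1 e) /= ?ea //.
apply: ltr_leD; last first.
  apply: ler_sum => e' _; rewrite ler_wpM2l ?wt_ge0 //.
  by apply: ler_prod => k _; rewrite x0 xy.
rewrite ltr_pM2l //; apply: (@prod_lt _ _ _ j) => // [k|]; first by rewrite x0 xy.
by rewrite ja'.
Qed.

Lemma grad_gt0 x : serial -> (forall a, 0 < x a) -> forall a, 0 < grad x a.
Proof.
move=> ser x0 a; have [a' [e [j [we ea _ _]]]] := ser a.
rewrite /grad (bigD1 e) /= ?ea // ltr_pwDl //.
  by rewrite mulr_gt0 // prodr_gt0.
apply: sumr_ge0 => e' _; rewrite mulr_ge0 ?wt_ge0 // prodr_ge0 // => k _.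
exact: ltW.
Qed.

(** Every entry occupies exactly one index of block i in position slot i, so
pairing a vector with block i of its gradient gives the same number for all i.
This is why the eigenvalues of the separate blocks coincide. *)
Lemma euler x i : \sum_(a | bid a == i) x a * grad x a = value x.
Proof.
rewrite /value (partition_big (fun e => pos e (slot i)) (fun a => bid a == i)) /=;
  last by move=> e _; rewrite bid_pos blk_slot.
apply: eq_bigr => a /eqP ai; rewrite /grad ai mulr_sumr.
apply: eq_bigr => e /eqP ea; rewrite [in RHS](bigD1 (slot i)) //= ea; ring.
Qed.

Lemma Fq_ge0 q x a : 0 <= Fq q x a. Proof. exact: powR_ge0. Qed.

Lemma Fq_gt0 q x : serial -> (forall a, 0 < x a) -> forall a, 0 < Fq q x a.
Proof. by move=> ser x0 a; rewrite powR_gt0 // grad_gt0. Qed.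

Lemma Fq_scale q delta x : (forall a, 0 <= x a) -> forall a,
  Fq q (scale delta x) a = expR (q (bid a) * rest delta (bid a)) * Fq q x a.
Proof.
move=> x0 a; rewrite /Fq grad_scale powRM ?expR_ge0 ?grad_ge0 //.
by rewrite [q _ * _]mulrC expRM.
Qed.

Lemma Fq_le q x y : (forall i, 0 < q i) ->
  (forall a, 0 <= x a) -> (forall a, x a <= y a) ->
  forall a, Fq q x a <= Fq q y a.
Proof.
move=> q0 x0 xy a; rewrite ge0_ler_powR ?nnegrE ?grad_ge0 ?grad_le //.
- exact: ltW.
- by move=> b; rewrite (le_trans (x0 b)).
Qed.

Lemma powRVK (t s : R) : 0 <= t -> s != 0 -> (t `^ s^-1) `^ s = t.
Proof. by move=> t0 s0; rewrite -powRrM mulVf // powRr1. Qed.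

Lemma powRKV (t s : R) : 0 <= t -> s != 0 -> (t `^ s) `^ s^-1 = t.
Proof. by move=> t0 s0; rewrite -powRrM mulfV // powRr1. Qed.

Lemma eigen_Fq q lam x : (forall i, 0 < q i) -> 0 <= lam -> (forall a, 0 <= x a) ->
  eigen q lam x -> forall a, Fq q x a = lam `^ q (bid a) * x a.
Proof.
move=> q0 l0 x0 [ex _] a; rewrite /Fq ex powRM ?powR_ge0 // powRVK //.
by rewrite gt_eqF.
Qed.

(** Pairing the eigenvalue equation of one block with the vector uses up the
normalization of that block. *)
Lemma eigen_value q lam x : (forall i, 0 < q i) -> (forall a, 0 <= x a) ->
  eigen q lam x -> D -> lam = value x.
Proof.
move=> q0 x0 [ex nx] i; rewrite -(euler x i) -[LHS]mulr1 -(nx i) mulr_sumr.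
apply: eq_bigr => a /eqP <-; rewrite ex mulrCA powRD ?powRr1 //.
by apply/implyP; rewrite gt_eqF // addr_gt0 // invr_gt0.
Qed.

Lemma value_ge0 x : (forall a, 0 <= x a) -> 0 <= value x.
Proof.
by move=> x0; apply: sumr_ge0 => e _; rewrite mulr_ge0 ?wt_ge0 ?prodr_ge0.
Qed.

Lemma normalized_neq0 q x i : (forall i, 0 < q i) -> (forall a, 0 <= x a) ->
  normalized q x -> exists2 a, bid a = i & 0 < x a.
Proof.
move=> q0 x0 nx; apply: contrapT => no.
suff s0 : \sum_(a | bid a == i) x a `^ (1 + (q i)^-1) = 0.
  by have := oner_neq0 R; rewrite -(nx i) s0 eqxx.
apply: big1 => a /eqP ai.
have xa : x a = 0.
  apply/eqP; rewrite eq_le x0 andbT leNgt; apply/negP => xa.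
  by apply: no; exists a.
by rewrite xa powR0 // gt_eqF // addr_gt0 // invr_gt0.
Qed.

Lemma normalized_le1 q x a : (forall i, 0 < q i) -> (forall a, 0 <= x a) ->
  normalized q x -> x a <= 1.
Proof.
move=> q0 x0 nx; have p0 : 0 < 1 + (q (bid a))^-1 by rewrite addr_gt0 // invr_gt0.
rewrite leNgt; apply/negP => xa; have := nx (bid a).
rewrite (bigD1 a) //= => s1; have : x a `^ (1 + (q (bid a))^-1) <= 1.
  by rewrite -[leRHS]s1 lerDl; apply: sumr_ge0 => *; exact: powR_ge0.
apply/negP; rewrite -ltNge.
have e1 : (1 : R) `^ (1 + (q (bid a))^-1) = 1 by rewrite powR1.
rewrite -[ltLHS]e1.
by apply: gt0_ltr_powR; rewrite ?nnegrE.
Qed.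

Lemma normalized_le_eq q x y : (forall i, 0 < q i) -> (forall a, 0 <= x a) ->
  (forall a, x a <= y a) -> normalized q x -> normalized q y -> x =1 y.
Proof.
move=> q0 x0 xy nx ny a; set i := bid a.
have p0 k : 0 < 1 + (q k)^-1 by rewrite addr_gt0 // invr_gt0.
have y0 b : 0 <= y b by rewrite (le_trans (x0 b)).
have := @psumr_eq0P R I (fun b => bid b == i)
  (fun b => y b `^ (1 + (q i)^-1) - x b `^ (1 + (q i)^-1)).
move=> /(_ _ _ a (eqxx _)) h.
have {}h : y a `^ (1 + (q i)^-1) - x a `^ (1 + (q i)^-1) = 0.
  apply: h; last by rewrite sumrB nx ny subrr.
  by move=> b _; rewrite subr_ge0 ge0_ler_powR ?nnegrE ?(ltW (p0 i)).
move/eqP: h; rewrite subr_eq0 => /eqP /powR_injective -> //; rewrite ?nnegrE //.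
Qed.

(** delta i is the logarithm of the largest ratio y a / x a in block i.  It is
nonnegative because x and y have equal norms. *)
Lemma contact q x y : (forall i, 0 < q i) -> (forall a, 0 < x a) ->
  (forall a, 0 <= y a) -> normalized q x -> normalized q y ->
  exists delta, [/\ forall i, 0 <= delta i,
    forall a, y a <= scale delta x a &
    forall i, exists2 a, bid a = i & y a = scale delta x a].
Proof.
move=> q0 x0 y0 nx ny.
(* f i is the index of block i where the ratio is largest. *)
have /choice[f Hf] i : exists b, bid b = i /\ 0 < y b /\
    forall a, bid a = i -> y a / x a <= y b / x b.
  have [a0 a0i ya0] := normalized_neq0 i q0 y0 ny.
  case: (@arg_maxP _ _ _ a0 (fun a => bid a == i) (fun a => y a / x a)).
    exact/eqP.
  move=> a /eqP ai am; exists a; split=> //.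
  have h b : bid b = i -> y b / x b <= y a / x a by move=> /eqP; exact: am.
  split=> //; have := h a0 a0i; rewrite ltNge => h1; apply/negP => ya.
  have : y a0 / x a0 <= 0.
    by rewrite (le_trans h1) // pmulr_lle0 // invr_gt0.
  by apply/negP; rewrite -ltNge divr_gt0.
pose delta i := ln (y (f i) / x (f i)).
have ed i : expR (delta i) = y (f i) / x (f i).
  by rewrite lnK // posrE divr_gt0 //; case: (Hf i) => _ [].
have le a : y a <= scale delta x a.
  by rewrite /scale ed -ler_pdivrMr //; case: (Hf (bid a)) => _ [_]; apply.
exists delta; split=> //.
  move=> i; rewrite leNgt; apply/negP => di.
  have p0 : 0 < 1 + (q i)^-1 by rewrite addr_gt0 // invr_gt0.
  have : \sum_(a | bid a == i) y a `^ (1 + (q i)^-1) <=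
      expR (delta i) `^ (1 + (q i)^-1) * \sum_(a | bid a == i) x a `^ (1 + (q i)^-1).
    rewrite mulr_sumr; apply: ler_sum => a /eqP ai.
    rewrite -powRM ?expR_ge0 ?(ltW (x0 _)) // ge0_ler_powR ?nnegrE ?(ltW p0) //.
    - by rewrite mulr_ge0 ?expR_ge0 ?(ltW (x0 _)).
    - by have := le a; rewrite /scale ai.
  rewrite nx ny mulr1 -expRM expR_ge1 leNgt pmulr_llt0 //.
  by rewrite di.
move=> i; exists (f i); first by case: (Hf i).
rewrite /scale; case: (Hf i) => -> _; rewrite ed divfK //.
by rewrite gt_eqF.
Qed.

End System.

(** * Collatz-Wielandt comparison, rigidity and fixed points *)

Section Perron.
Context {R : realType} {D P I E : finType} (S : system R D P I E).
Implicit Types (x y z u : I -> R) (delta q w c B : D -> R) (a : I) (i : D) (e : E).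
Local Notation bid := (bid S).

(** The two positive eigenvectors of the homogeneity matrix, for one eigenvalue:
w is used to eliminate delta from inequalities, c to build invariant boxes. *)
Record perron_data q (rho : R) w c : Prop := Perron {
  q_gt0 : forall i, 0 < q i ;
  w_gt0 : forall i, 0 < w i ;
  c_gt0 : forall i, 0 < c i ;
  left_eigen : forall delta,
    \sum_i w i * (q i * rest S delta i) = rho * \sum_i w i * delta i ;
  right_eigen : forall i, q i * rest S c i = rho * c i
}.

Lemma perron_scaled t q rho w c : 0 < t -> perron_data q rho w c ->
  perron_data (fun i => t * q i) (t * rho) w c.
Proof.
move=> t0 [q0 w0 c0 wA Ac]; split=> // [i|delta|i].
- by rewrite mulr_gt0.
- rewrite -mulrA -wA mulr_sumr; apply: eq_bigr => i _; ring.
- by rewrite -!mulrA Ac.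
Qed.

Lemma prod_powR B w : (forall i, 0 < B i) ->
  \prod_i B i `^ w i = expR (\sum_i w i * ln (B i)).
Proof.
move=> B0; rewrite expR_sum; apply: eq_bigr => i _.
by rewrite mulrC expRM lnK // posrE.
Qed.

Lemma rest_scale (t : R) delta i : rest S (fun k => t * delta k) i = t * rest S delta i.
Proof. by rewrite /rest mulr_sumr. Qed.

(** Both hypotheses are read at the contact index of the block, where
y a = exp (delta i) * x a. *)
Lemma cw_contact q x y B (alpha : D -> R) : (forall i, 0 < q i) ->
  (forall a, 0 < x a) -> (forall a, 0 <= y a) -> normalized S q x -> normalized S q y ->
  (forall a, Fq S q x a <= B (bid a) * x a) ->
  (forall a, alpha (bid a) * y a <= Fq S q y a) ->
  exists delta, [/\ forall i, 0 <= delta i,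
    forall a, y a <= scale S delta x a,
    forall i, exists2 a, bid a = i & y a = scale S delta x a &
    forall i, alpha i * expR (delta i) <= expR (q i * rest S delta i) * B i].
Proof.
move=> q0 x0 y0 nx ny xB ya.
have [delta [d0 yx ct]] := contact q0 x0 y0 nx ny.
exists delta; split=> // i; have [a <- yae] := ct i.
have yaE : expR (delta (bid a)) * x a = y a by rewrite yae.
rewrite -(ler_pM2r (x0 a)) -!mulrA yaE.
apply: le_trans (ya a) _.
apply: le_trans (ler_wpM2l (expR_ge0 _) (xB a)).
rewrite -Fq_scale; last by move=> b; exact: ltW.
exact: Fq_le.
Qed.

(** Taking the w-weighted sum of logarithms in [cw_contact], delta contributes
(rho - 1) * sum_i w i * delta i <= 0. *)
Lemma cw_le q rho w c x y B (alpha : D -> R) :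
  perron_data q rho w c -> rho <= 1 ->
  (forall a, 0 < x a) -> (forall a, 0 <= y a) -> normalized S q x -> normalized S q y ->
  (forall i, 0 < B i) -> (forall i, 0 <= alpha i) ->
  (forall a, Fq S q x a <= B (bid a) * x a) ->
  (forall a, alpha (bid a) * y a <= Fq S q y a) ->
  \prod_i alpha i `^ w i <= \prod_i B i `^ w i.
Proof.
move=> [q0 w0 c0 wA Ac] r1 x0 y0 nx ny B0 al0 xB ya.
have [delta [d0 _ _ h]] := cw_contact q0 x0 y0 nx ny xB ya.
have [al|] := pselect (forall i, 0 < alpha i); last first.
  move=> /existsNP[i /negP]; rewrite -leNgt => ai.
  have ai0 : alpha i = 0 by apply/eqP; rewrite eq_le ai al0.
  rewrite (bigD1 i) //= ai0 powR0 ?mul0r ?gt_eqF //.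
  by apply: prodr_ge0 => k _; exact: powR_ge0.
rewrite !prod_powR // ler_expR.
have h' i : w i * ln (alpha i) + w i * delta i <=
    w i * (q i * rest S delta i) + w i * ln (B i).
  rewrite -!mulrDr ler_wpM2l ?(ltW (w0 _)) //.
  have := h i; rewrite -ler_ln ?posrE ?mulr_gt0 ?expR_gt0 //.
  by rewrite !lnM ?posrE ?expR_gt0 // !expRK.
have : \sum_i (w i * ln (alpha i) + w i * delta i) <=
       \sum_i (w i * (q i * rest S delta i) + w i * ln (B i)).
  by apply: ler_sum => i _; exact: h'.
rewrite !big_split /= wA.
have : 0 <= \sum_i w i * delta i by apply: sumr_ge0 => i _; rewrite mulr_ge0 ?(ltW (w0 _)).
nra.
Qed.

Lemma eigen_gt0 q lam u : serial S -> (forall i, 0 < q i) ->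
  (forall a, 0 < u a) -> eigen S q lam u -> I -> 0 < lam.
Proof.
move=> ser q0 u0 [eu _] a; have := grad_gt0 ser u0 a; rewrite eu pmulr_lgt0 //.
by rewrite powR_gt0.
Qed.

(** The equality case of the comparison.  Since theta >= lam, contact forces
delta <= A delta, and the weighted sum shows that this is an equality.  For
rho < 1 it yields delta = 0.  For rho = 1 the gradients of y and of
exp delta u agree at contact indices; as gradients increase strictly along
edges, the contact set is closed under edges and hence everything. *)
Lemma rigidity q rho w c lam theta u y :
  perron_data q rho w c -> rho <= 1 -> serial S ->
  rho < 1 \/ irreducible_system S ->
  (forall a, 0 < u a) -> (forall a, 0 <= y a) ->
  eigen S q lam u -> eigen S q theta y -> lam <= theta -> y =1 u.
Proof.
move=> [q0 w0 c0 wA Ac] r1 ser hr u0 y0 eu ey lt a0.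
have l0 : 0 < lam := eigen_gt0 ser q0 u0 eu a0.
have t0 : 0 <= theta by rewrite (le_trans (ltW l0)).
have u0' a : 0 <= u a by exact: ltW.
have Fu := eigen_Fq q0 (ltW l0) u0' eu.
have Fy := eigen_Fq q0 t0 y0 ey.
have [||delta [d0 le ct h]] :=
    @cw_contact q u y (fun i => lam `^ q i) (fun i => theta `^ q i) q0 u0 y0 eu.2 ey.2.
- by move=> a; rewrite Fu.
- by move=> a; rewrite Fy.
have lq i : lam `^ q i <= theta `^ q i by rewrite ge0_ler_powR ?nnegrE ?(ltW l0) ?(ltW (q0 _)).
have dle i : delta i <= q i * rest S delta i.
  rewrite -ler_expR -(ler_pM2l (powR_gt0 (q i) l0)).
  apply: le_trans (ler_wpM2r (expR_ge0 _) (lq i)) _.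
  by rewrite [leRHS]mulrC.
have s0 : 0 <= \sum_i w i * delta i by apply: sumr_ge0 => i _; rewrite mulr_ge0 ?(ltW (w0 _)).
have sum0 : \sum_i w i * (q i * rest S delta i - delta i) = (rho - 1) * \sum_i w i * delta i.
  rewrite mulrBl mul1r -wA -sumrB; apply: eq_bigr => i _; ring.
have ge i : 0 <= w i * (q i * rest S delta i - delta i).
  by rewrite mulr_ge0 ?subr_ge0 ?(ltW (w0 _)).
have sz : \sum_i w i * (q i * rest S delta i - delta i) = 0.
  apply/eqP; rewrite eq_le sumr_ge0 ?andbT //; rewrite sum0; nra.
case: hr => [rlt|conn].
  have sd : \sum_i w i * delta i = 0.
    have : (rho - 1) * \sum_i w i * delta i = 0 by rewrite -sum0.
    by move=> /eqP; rewrite mulf_eq0 subr_eq0 lt_eqF //= => /eqP.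
  have d00 i : delta i = 0.
    have /eqP : w i * delta i = 0.
      by apply: (psumr_eq0P _ sd) => // k _; apply: mulr_ge0 => //; exact: ltW.
    by rewrite mulf_eq0 gt_eqF //= => /eqP.
  apply: (normalized_le_eq q0 y0 _ ey.2 eu.2) => a.
  by have := le a; rewrite /scale d00 expR0 mul1r.
(* In the other case equality is propagated along edges. *)
have deq i : q i * rest S delta i = delta i.
  have /eqP : w i * (q i * rest S delta i - delta i) = 0.
    by apply: (psumr_eq0P _ sz).
  by rewrite mulf_eq0 gt_eqF //= subr_eq0 => /eqP.
set v := scale S delta u.
have v0 : forall a, 0 < v a by exact: scale_gt0.
have yv : y =1 v.
  pose J := [set a | y a == v a]%SET.
  have [JT|JT] := eqVneq J [set: I]%SET.
    move=> a; apply/eqP; have : a \in J by rewrite JT finset.in_setT.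
    by rewrite inE.
  have J0 : J != finset.set0.
    have [a _ ya] := ct (bid a0).
    by apply/set0Pn; exists a; rewrite inE ya.
  have [a [a' [aJ a'J aa']]] := conn _ J0 JT; exfalso.
  rewrite inE in a'J; have ya' : y a' < v a' by rewrite lt_neqAle le andbT.
  have glt := grad_lt y0 le v0 aa' ya'.
  have : Fq S q y a < Fq S q v a.
    by apply: gt0_ltr_powR; rewrite ?nnegrE ?grad_ge0 // => b; exact: ltW.
  apply/negP; rewrite -leNgt Fy Fq_scale // deq Fu.
  rewrite inE in aJ; rewrite (eqP aJ) /v /scale mulrCA ler_wpM2r ?lq //.
  by rewrite mulr_ge0 ?expR_ge0.
apply/esym/(normalized_le_eq q0 u0' _ eu.2 ey.2) => a.
by rewrite yv /v /scale ler_peMl // expR_ge1.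
Qed.

(** The Knaster-Tarski argument.  With A c = rho c and rho < 1, scaling by
exp (L c) costs only exp (rho L c), so for large L the vector exp (L c) is a
supersolution and exp (- L c) a subsolution.  The pointwise infimum of the
supersolutions above the latter is a fixed point, since F is order preserving. *)
Lemma fixed_point q rho w c : perron_data q rho w c -> rho < 1 -> serial S ->
  exists2 x, (forall a, 0 < x a) & forall a, Fq S q x a = x a.
Proof.
move=> [q0 w0 c0 wA Ac] r1 ser.
pose one : I -> R := fun=> 1.
have one0 a : 0 < one a by [].
have one0' a : 0 <= one a by [].
pose L := \sum_a `|ln (Fq S q one a)| / ((1 - rho) * c (bid a)).
have rc i : 0 < (1 - rho) * c i by rewrite mulr_gt0 // subr_gt0.
have hL a : `|ln (Fq S q one a)| <= L * ((1 - rho) * c (bid a)).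
  rewrite -ler_pdivrMr // /L (bigD1 a) //= lerDl; apply: sumr_ge0 => b _.
  by rewrite divr_ge0 // ltW.
have F1 a : 0 < Fq S q one a by exact: Fq_gt0.
pose box t := scale S (fun i => t * c i) one.
have Fbox t a : Fq S q (box t) a = expR (rho * t * c (bid a) + ln (Fq S q one a)).
  rewrite Fq_scale // expRD lnK ?posrE // rest_scale; congr (expR _ * _).
  rewrite mulrCA Ac; ring.
have boxE t a : box t a = expR (t * c (bid a)) by rewrite /box /scale mulr1.
have box0 t a : 0 < box t a by rewrite boxE expR_gt0.
have box0' t a : 0 <= box t a by exact: ltW.
have up a : Fq S q (box L) a <= box L a.
  rewrite Fbox boxE ler_expR; have := hL a; rewrite ler_norml => /andP[_]; lra.
have dn a : box (- L) a <= Fq S q (box (- L)) a.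
  rewrite Fbox boxE ler_expR; have := hL a; rewrite ler_norml => /andP[+ _]; lra.
have L0 : 0 <= L.
  by apply: sumr_ge0 => a _; rewrite divr_ge0 // ltW.
pose X : set (I -> R) := [set x | (forall a, box (- L) a <= x a) /\
                                  forall a, Fq S q x a <= x a].
pose xs a := inf [set x a | x in X].
have XL : X (box L).
  split=> // a; rewrite !boxE ler_expR ler_wpM2r ?(ltW (c0 _)) //; lra.
have lb a : has_lbound [set x a | x in X].
  by exists (box (- L) a) => _ [x [lx _] <-].
have ne a : [set x a | x in X] !=set0 by exists (box L a); exists (box L).
have xs_le x : X x -> forall a, xs a <= x a.
  by move=> Xx a; apply: ge_inf => //; exists x.
have xs_ge a : box (- L) a <= xs a.
  by apply: lb_le_inf => // _ [x [lx _] <-].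
have xs0 a : 0 < xs a by rewrite (lt_le_trans (box0 (- L) a)).
have xs0' a : 0 <= xs a by exact: ltW.
have Fxs a : Fq S q xs a <= xs a.
  apply: lb_le_inf => // _ [x Xx <-].
  by apply: le_trans (Xx.2 a); apply: Fq_le => // b; exact: xs_le.
exists xs => // a; apply/eqP; rewrite eq_le Fxs /=.
apply: (xs_le (Fq S q xs)); split=> b.
  by apply: le_trans (dn b) _; exact: Fq_le.
by apply: Fq_le => // b'; exact: Fq_ge0.
Qed.

(** One eigenvalue per block suffices, by [euler]. *)
Lemma eigen_of_blocks q (mu : D -> R) u : (forall i, 0 < q i) -> (forall a, 0 <= u a) ->
  normalized S q u -> (forall a, grad S u a = mu (bid a) * u a `^ (q (bid a))^-1) ->
  eigen S q (value S u) u.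
Proof.
move=> q0 u0 nu gu; split=> // a; rewrite gu; congr (_ * _).
rewrite -(euler S u (bid a)) -[LHS]mulr1 -(nu (bid a)) mulr_sumr.
apply: eq_bigr => b /eqP bi; rewrite gu bi mulrCA powRD ?powRr1 //.
by apply/implyP; rewrite gt_eqF // addr_gt0 // invr_gt0.
Qed.

(** The logarithm of the inverse of the norm of block i. *)
Definition log_normalizer q x i : R :=
  - (ln (\sum_(a | bid a == i) x a `^ (1 + (q i)^-1)) / (1 + (q i)^-1)).

Lemma normalize q x : (forall i, 0 < q i) -> (forall a, 0 < x a) ->
  normalized S q (scale S (log_normalizer q x) x).
Proof.
move=> q0 x0 i; set pp := 1 + _.
have p0 : 0 < pp by rewrite addr_gt0 // invr_gt0.
have N0 : 0 < \sum_(a | bid a == i) x a `^ pp.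
  have [a ai] := bid_surj S i.
  rewrite (bigD1 a) /= ?ai // ltr_pwDl ?powR_gt0 //.
  by apply: sumr_ge0 => *; exact: powR_ge0.
have -> : \sum_(a | bid a == i) scale S (log_normalizer q x) x a `^ pp =
   expR (log_normalizer q x i * pp) * \sum_(a | bid a == i) x a `^ pp.
  rewrite mulr_sumr; apply: eq_bigr => a /eqP ai.
  by rewrite /scale powRM ?expR_ge0 ?(ltW (x0 _)) // ai -expRM.
by rewrite /log_normalizer mulNr divfK ?gt_eqF // expRN lnK ?posrE // mulVf // gt_eqF.
Qed.

Lemma positive_eigen q rho w c : perron_data q rho w c -> rho < 1 -> serial S ->
  exists lam u, (forall a, 0 < u a) /\ eigen S q lam u.
Proof.
move=> pr r1 ser; have [x x0 fx] := fixed_point pr r1 ser.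
have q0 := q_gt0 pr.
set d := log_normalizer q x; set u := scale S d x.
have u0 : forall a, 0 < u a by exact: scale_gt0.
exists (value S u), u; split=> //.
apply: (@eigen_of_blocks _ (fun i => expR (rest S d i - d i / q i))) => //.
- by move=> a; exact: ltW.
- exact: normalize.
move=> a; rewrite grad_scale.
have -> : grad S x a = x a `^ (q (bid a))^-1.
  by rewrite -(fx a) powRKV ?grad_ge0 ?gt_eqF // => b; exact: ltW.
rewrite powRM ?expR_ge0 ?(ltW (x0 _)) // -expRM mulrA -expRD.
by rewrite subrK.
Qed.

End Perron.

(** * Limits and uniform bounds *)

Section Limits.
Context {R : realType}.

(** Limits along an ultrafilter replace the extraction of subsequences, so that
each coordinate can be treated separately. *)
Lemma ultra_cvg (T : Type) (U : set_system T) (f : T -> R) (A B : R) :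
  UltraFilter U -> (forall k, A <= f k <= B) ->
  exists l : R, f k @[k --> U] --> l.
Proof.
move=> UU fAB; have FU : ProperFilter U by exact: ultra_proper.
have [l [_ cl]] : `[A, B] `&` cluster (f @ U) !=set0.
  apply: segment_compact; apply: (@filterE _ U) => k /=.
  by rewrite in_itv /= fAB.
exists l => N Nl.
have [//|hN] := in_ultra_setVsetC (f @^-1` N) UU.
by have [y []] := cl (~` N) N hN Nl.
Qed.

Lemma powR_cvg (T : Type) (U : set_system T) (f : T -> R) (l s : R) :
  ProperFilter U -> 0 < s -> (forall k, 0 <= f k) -> f k @[k --> U] --> l ->
  f k `^ s @[k --> U] --> l `^ s.
Proof.
move=> FU s0 f0 fl.
have l0 : 0 <= l.
  rewrite -(cvg_lim (@Rhausdorff R) fl); apply: limr_ge; first exact: cvgP fl.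
  exact: (@filterE _ U).
have [lz|lz] := eqVneq l 0; last first.
  have lp : 0 < l by rewrite lt_def lz.
  have dc : {for l, continuous (fun t : R => t `^ s)}.
    apply: differentiable_continuous; apply/derivable1_diffP.
    by have := @is_derive1_powR R s l lp; case.
  exact: (continuous_cvg _ dc fl).
rewrite lz powR0 ?gt_eqF //; apply/cvgrPdist_lt => eps eps0.
have d0 : 0 < eps `^ s^-1 by rewrite powR_gt0.
move/cvgrPdist_lt : fl => /(_ _ d0); apply: filterS => k.
rewrite lz !sub0r !normrN ger0_norm // ger0_norm ?powR_ge0 // => fk.
have -> : eps = (eps `^ s^-1) `^ s by rewrite -powRrM mulVf ?gt_eqF // powRr1 // ltW.
by apply: gt0_ltr_powR; rewrite ?nnegrE ?powR_ge0.
Qed.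

(** Uniform control of a change of exponent: for t > 0 one has
t - t `^ r <= t * (r - 1) * - ln t and - t * ln t <= 1. *)
Lemma powR_near_self (t r : R) : 0 <= t <= 1 -> 1 <= r -> 0 <= t - t `^ r <= r - 1.
Proof.
move=> /andP[t0 t1] r1.
have [->|tz] := eqVneq t 0.
  by rewrite powR0 ?gt_eqF ?(lt_le_trans ltr01) // subr0 lexx subr_ge0.
have tp : 0 < t by rewrite lt_def tz.
have tr : t `^ r = t * expR ((r - 1) * ln t).
  rewrite -{1}(lnK (x:=t)) ?posrE // -expRM -[X in X * expR _](lnK (x:=t)) ?posrE //.
  rewrite -expRD; congr expR; ring.
have lt0 : ln t <= 0 by rewrite ln_le0.
have h1 : 1 + (r - 1) * ln t <= expR ((r - 1) * ln t) by exact: expR_ge1Dx.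
have h2 : 1 - ln t <= t^-1 by rewrite -[t in t^-1](lnK (x:=t)) ?posrE // -expRN expR_ge1Dx.
have h3 : expR ((r - 1) * ln t) <= 1 by rewrite expR_le1; nra.
have h4 : t * (1 - ln t) <= 1 by rewrite -ler_pdivlMl // mulr1.
rewrite tr; apply/andP; split; nra.
Qed.

End Limits.

Section GradLimits.
Context {R : realType} {D P I E : finType} (S : system R D P I E).

Lemma grad_cvg (T : Type) (U : set_system T) (X : T -> I -> R) (u : I -> R) a :
  ProperFilter U -> (forall a, X k a @[k --> U] --> u a) ->
  grad S (X k) a @[k --> U] --> grad S u a.
Proof.
move=> FU Xu; rewrite /grad; apply: cvg_big => [|e _]; first exact: add_continuous.
apply: cvgM; first exact: cvg_cst.
by apply: cvg_big => [|j _]; [exact: mul_continuous|exact: Xu].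
Qed.

Lemma value_cvg (T : Type) (U : set_system T) (X : T -> I -> R) (u : I -> R) :
  ProperFilter U -> (forall a, X k a @[k --> U] --> u a) ->
  value S (X k) @[k --> U] --> value S u.
Proof.
move=> FU Xu; rewrite /value; apply: cvg_big => [|e _]; first exact: add_continuous.
apply: cvgM; first exact: cvg_cst.
by apply: cvg_big => [|j _]; [exact: mul_continuous|exact: Xu].
Qed.

End GradLimits.

Section Existence.
Context {R : realType} {D P I E : finType} (S : system R D P I E).
Implicit Types (x y z u : I -> R) (delta q w c B : D -> R) (a : I) (i : D) (e : E).
Local Notation bid := (bid S).

(** Within a block, the entries of positive eigenvectors are comparable,
uniformly in the exponent factor t.  In logarithms, let mu i be the minimum of
block i.  The eigenvalue equation bounds mu - t A mu below, and its
w-weighted sum is (1 - t rho) sum_i w i * mu i <= 0, so it is bounded above as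
well.  Hence an edge from a to a' bounds the excess of ln (x a') over the
minimum of its block by that of ln (x a), and irreducibility carries the bound
from one index where the excess vanishes to all indices. *)
Lemma ratio_bound q rho w c : perron_data S q rho w c -> rho <= 1 -> serial S ->
  irreducible_system S ->
  exists K, forall t lam x, 1 / 2 <= t <= 1 -> (forall a, 0 < x a) ->
    eigen S (fun i => t * q i) lam x ->
    forall a b, bid a = bid b -> ln (x a) - ln (x b) <= K.
Proof.
move=> [q0 w0 c0 wA Ac] r1 ser irr.
pose L := ln (value S (fun=> 1)).
pose Ce := (\sum_i q i) * (\sum_e `|ln (wt S e)| + `|L|).
pose Cg := \sum_i Ce * (\sum_k w k) / w i.
pose Q := \sum_i 2 / q i.
have sw0 : 0 <= \sum_k w k by apply: sumr_ge0 => i _; exact: ltW.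
have lw0 : 0 <= \sum_e `|ln (wt S e)| by apply: sumr_ge0.
have C10 : 0 <= Ce.
  by rewrite mulr_ge0 ?addr_ge0 //; apply: sumr_ge0 => i _; exact: ltW.
have C20 : 0 <= Cg.
  by apply: sumr_ge0 => i _; rewrite divr_ge0 ?(mulr_ge0 C10 sw0) // ltW.
have Q0 : 0 <= Q by apply: sumr_ge0 => i _; rewrite divr_ge0 // ltW.
pose good (t : R) lam x := [/\ 1 / 2 <= t <= 1, (forall a, 0 < x a) &
    eigen S (fun i => t * q i) lam x].
pose gap x (K : R) a := forall b, bid b = bid a -> ln (x a) - ln (x b) <= K.
have step t lam x (K : R) a a' : good t lam x -> edge S a a' -> gap x K a ->
    gap x (Q * (Ce + Cg + K)) a'.
  move=> [/andP[t1 t2] x0 ex] [e [j [we ea ja ja']]] ga.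
  have t0 : 0 < t by lra.
  have tq0 i : 0 < t * q i by rewrite mulr_gt0.
  have x0' b : 0 <= x b by exact: ltW.
  have x1 b : x b <= 1 by exact: normalized_le1 tq0 x0' ex.2.
  have l0 : 0 < lam by exact: eigen_gt0 ser tq0 x0 ex a.
  have lL : ln lam <= L.
    have lv := eigen_value tq0 x0' ex (bid a).
    have vle : value S x <= value S (fun=> 1).
      apply: ler_sum => e' _; rewrite ler_wpM2l ?wt_ge0 //.
      by apply: ler_prod => k _; rewrite x0' x1.
    rewrite lv in l0 *; rewrite /L ler_ln ?posrE //; exact: lt_le_trans vle.
  have key e' b : 0 < wt S e' -> pos S e' (slot S (bid b)) = b ->
      - Ce + t * q (bid b) * \sum_(k | k != slot S (bid b)) ln (x (pos S e' k))
      <= ln (x b).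
    move=> we' eb; have tqb := tq0 (bid b).
    have prodE : \prod_(k | k != slot S (bid b)) x (pos S e' k) =
        expR (\sum_(k | k != slot S (bid b)) ln (x (pos S e' k))).
      by rewrite expR_sum; apply: eq_bigr => k _; rewrite lnK ?posrE.
    have : wt S e' * \prod_(k | k != slot S (bid b)) x (pos S e' k) <=
        lam * x b `^ (t * q (bid b))^-1.
      rewrite -(ex.1 b) /grad (bigD1 e') /= ?eb // lerDl.
      apply: sumr_ge0 => e'' _; rewrite mulr_ge0 ?wt_ge0 //.
      exact: prodr_ge0.
    rewrite prodE -ler_ln ?posrE ?mulr_gt0 ?expR_gt0 ?powR_gt0 //.
    rewrite !lnM ?posrE ?expR_gt0 ?powR_gt0 // expRK ln_powR.
    set Sg := \sum_(k | _) _ => hl.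
    have hA : - (\sum_e `|ln (wt S e)| + `|L|) <= ln (wt S e') - ln lam.
      have : - `|ln (wt S e')| <= ln (wt S e') by rewrite lerNnormlW.
      have : L <= `|L| by exact: ler_norm.
      have : `|ln (wt S e')| <= \sum_e `|ln (wt S e)|.
        by rewrite (bigD1 e') //= lerDl; apply: sumr_ge0.
      lra.
    have hq : t * q (bid b) <= \sum_i q i.
      apply: le_trans (_ : q (bid b) <= _).
        by rewrite ler_piMl // ltW.
      by rewrite (bigD1 (bid b)) //= lerDl; apply: sumr_ge0 => i _; exact: ltW.
    have hC : - Ce <= t * q (bid b) * (ln (wt S e') - ln lam).
      apply: le_trans (ler_wpM2l (ltW tqb) hA).
      rewrite mulrN lerN2 /Ce ler_wpM2r ?addr_ge0 //.
    have : t * q (bid b) * (ln (wt S e') + Sg - ln lam) <= ln (x b).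
      by rewrite -ler_pdivlMl // lerBlDl.
    lra.
  have /choice[m Hm] i : exists b, bid b = i /\
      forall b', bid b' = i -> ln (x b) <= ln (x b').
    have [b0 b0i] := bid_surj S i.
    case: (@arg_minP _ _ _ b0 (fun b => bid b == i) (fun b => ln (x b))).
      exact/eqP.
    move=> b /eqP bi bm; exists b; split=> // b' /eqP; exact: bm.
  pose mu i := ln (x (m i)).
  have mule b : mu (bid b) <= ln (x b) by case: (Hm (bid b)) => _; apply.
  have mu0 i : mu i <= 0 by exact: ln_le0.
  have summu (i : D) e' : rest S mu i <= \sum_(k | k != slot S i) ln (x (pos S e' k)).
    by apply: ler_sum => k _; rewrite -(bid_pos S e' k).
  pose g i := mu i - t * q i * rest S mu i + Ce.
  have g0 i : 0 <= g i.
    have [bm _] := Hm i; have [b [e' [j' [we' eb _ _]]]] := ser (m i).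
    have := key e' (m i) we' eb; rewrite -/(mu i) bm.
    have := ler_wpM2l (ltW (tq0 i)) (summu i e'); rewrite /g; lra.
  have sg : \sum_i w i * g i <= Ce * \sum_k w k.
    have -> : \sum_i w i * g i = (1 - t * rho) * (\sum_i w i * mu i) + Ce * \sum_k w k.
      rewrite mulrBl mul1r -mulrA -wA !mulr_sumr -sumrB -big_split /=.
      apply: eq_bigr => i _; rewrite /g; ring.
    rewrite gerDr mulr_ge0_le0 //; first nra.
    by apply: sumr_le0 => i _; rewrite mulr_ge0_le0 // ltW.
  (* All terms of the sum are nonnegative, so each is bounded by the sum. *)
  have gC i : g i <= Cg.
    apply: le_trans (_ : Ce * (\sum_k w k) / w i <= _).
      rewrite ler_pdivlMr // mulrC; apply: le_trans sg.
      rewrite (bigD1 i) //= lerDl; apply: sumr_ge0 => k _.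
      by rewrite mulr_ge0 // ltW.
    rewrite /Cg [leRHS](bigD1 i) //= lerDl; apply: sumr_ge0 => k _.
    by rewrite divr_ge0 ?(mulr_ge0 C10 sw0) // ltW.
  have sumj : rest S mu (bid a) + (ln (x a') - mu (bid a')) <=
      \sum_(k | k != slot S (bid a)) ln (x (pos S e k)).
    rewrite /rest (bigD1 j) //= [leRHS](bigD1 j) //= ja'.
    have -> : blk S j = bid a' by rewrite -ja' bid_pos.
    have : \sum_(i | (i != slot S (bid a)) && (i != j)) mu (blk S i) <=
       \sum_(i | (i != slot S (bid a)) && (i != j)) ln (x (pos S e i)).
      by apply: ler_sum => k _; rewrite -(bid_pos S e k).
    lra.
  have h1 := key e a we ea.
  have h2 := ler_wpM2l (ltW (tq0 (bid a))) sumj.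
  have h3 := gC (bid a).
  have h4 : ln (x a) - mu (bid a) <= K by apply: ga; case: (Hm (bid a)).
  have h5 : t * q (bid a) * (ln (x a') - mu (bid a')) <= Ce + Cg + K.
    by rewrite /g in h3; lra.
  have dl0 : 0 <= ln (x a') - mu (bid a') by rewrite subr_ge0.
  have N0 : 0 <= Ce + Cg + K.
    by apply: le_trans h5; rewrite mulr_ge0 // ltW.
  move=> b' bb'; have h6 := mule b'; rewrite bb' in h6.
  apply: le_trans (_ : ln (x a') - mu (bid a') <= _); first lra.
  apply: le_trans (_ : 2 / q (bid a) * (Ce + Cg + K) <= _).
    rewrite mulrAC ler_pdivlMr //.
    have qa := q0 (bid a); nra.
  rewrite ler_wpM2r // /Q (bigD1 (bid a)) //= lerDl.
  by apply: sumr_ge0 => k _; rewrite divr_ge0 // ltW.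
(* The set of indices with bounded excess grows with the bound until it is
   everything; the bound depends on the number of steps only. *)
pose J x (K : R) : {set I} := [set a | `[< gap x K a >]]%SET.
have grow n : exists K, forall t lam x, good t lam x ->
    J x K = [set: I]%SET \/ (n < #|J x K|)%N.
  elim: n => [|n [K IH]].
    exists 0 => t lam x gx; case: (pickP (@predT I)) => [a0 _|no]; last first.
      by left; apply/setP => a; have := no a.
    right; apply/card_gt0P.
    case: (@arg_minP _ _ _ a0 predT x) => // a _ am.
    exists a; rewrite inE; apply/asboolP => b _; rewrite subr_le0.
    by have [_ x0 _] := gx; rewrite ler_ln ?posrE // am.
  exists (Num.max K (Q * (Ce + Cg + K))) => t lam x gx.
  have sub : J x K \subset J x (Num.max K (Q * (Ce + Cg + K))).
    apply/fintype.subsetP => a; rewrite inE => /asboolP ga.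
    by rewrite inE; apply/asboolP => b bb; rewrite le_max ga.
  have [JT|JT] := eqVneq (J x K) [set: I]%SET.
    by left; apply/eqP; rewrite finset.eqEsubset finset.subsetT /= -JT.
  have {IH} [/eqP|lt] := IH _ _ _ gx; first by rewrite (negPf JT).
  have J0 : J x K != finset.set0 by rewrite -card_gt0 (leq_ltn_trans _ lt).
  have [a [a' [aJ a'J aa']]] := irr _ J0 JT.
  right; apply: (@leq_ltn_trans #|J x K|) => //; apply: proper_card.
  apply/properP; split=> //; exists a' => //; rewrite inE; apply/asboolP => b bb.
  rewrite le_max (step _ _ _ _ _ _ gx aa') ?orbT //.
  by move: aJ; rewrite inE => /asboolP.
have [K HK] := grow #|I|.
exists K => t lam x t01 x0 ex a b ab.
have [|JT|] := HK t lam x; first by split.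
  have : a \in J x K by rewrite JT finset.in_setT.
  by rewrite inE => /asboolP; apply.
by rewrite ltnNge max_card.
Qed.
End Existence.

(** * Existence of a nonnegative eigenpair *)

Section Existence.
Context {R : realType} {D P I E : finType} (S : system R D P I E).
Implicit Types (x y z u : I -> R) (delta q w c B : D -> R) (a : I) (i : D) (e : E).
Local Notation bid := (bid S).

Lemma sum1_inhabited (f : D -> R) : \sum_i f i = 1 -> inhabited D.
Proof.
have [i _ _|no] := pickP (@predT D); first by split.
rewrite big1 => [/esym/eqP|i]; first by rewrite oner_eq0.
by have := no i.
Qed.

(** This fixes the normalization of w: the bounds lam `^ q i obtained from an
eigenvector multiply up to its eigenvalue. *)
Lemma prod_powR_eigenvalue q w (lam : R) : (forall i, 0 < q i) -> (forall i, 0 < w i) ->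
  \sum_i w i * q i = 1 -> 0 <= lam -> \prod_i (lam `^ q i) `^ w i = lam.
Proof.
move=> q0 w0 wq l0; have [->|lz] := eqVneq lam 0.
  have [i1] := sum1_inhabited wq.
  by rewrite (bigD1 i1) //= powR0 ?powR0 ?mul0r // gt_eqF.
have lp : 0 < lam by rewrite lt_def lz.
rewrite prod_powR; last by move=> i; rewrite powR_gt0.
under eq_bigr do rewrite ln_powR mulrA.
by rewrite -mulr_suml wq mul1r lnK.
Qed.

(** For rho = 1, let X k be a positive eigenvector for the exponents t k * q i
with t k tending to 1, and u its limit along an ultrafilter.  Replacing the
exponent t k * q i by q i turns the eigenvalue equation of X k into
Fq (X k) <= lam `^ q i * X k, because the entries are at most one; as rho = 1,
normalizing X k does not change the weighted product of these bounds. *)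
Lemma nonneg_eigenpair_exists q rho w c : perron_data S q rho w c -> rho <= 1 ->
  \sum_i w i * q i = 1 -> serial S ->
  exists lam u, [/\ 0 <= lam, forall a, 0 <= u a, eigen S q lam u,
    forall eps, 0 < eps -> exists x B, [/\ forall a, 0 < x a, normalized S q x,
      forall i, 0 < B i, forall a, Fq S q x a <= B (bid a) * x a &
      \prod_i B i `^ w i <= lam + eps] &
    rho < 1 \/ irreducible_system S -> forall a, 0 < u a].
Proof.
move=> pr r1 wq ser; have [q0 w0 c0 wA Ac] := pr.
have [i0] := sum1_inhabited wq.
have [a0 _] := bid_surj S i0.
have [rlt|rge] := ltP rho 1.
  have [lam [u [u0 eu]]] := positive_eigen pr rlt ser.
  have l0 := eigen_gt0 ser q0 u0 eu a0.
  have u0' a : 0 <= u a by exact: ltW.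
  exists lam, u; split=> //; first exact: ltW.
  move=> eps eps0; exists u, (fun i => lam `^ q i); split=> //.
  - by case: eu.
  - by move=> i; rewrite powR_gt0.
  - by move=> a; rewrite (eigen_Fq q0 (ltW l0) u0' eu).
  - by rewrite prod_powR_eigenvalue // ?lerDl ltW.
have {r1 rge} rho1 : rho = 1 by apply/eqP; rewrite eq_le r1.
(* Starting from k.+2 keeps t k in [1 / 2, 1[, as ratio_bound requires. *)
pose t (k : nat) : R := 1 - k.+2%:R^-1.
have thalf k : 1 / 2 <= t k.
  have : k.+2%:R^-1 <= 1 / 2 :> R by rewrite div1r lef_pV2 ?posrE ?ltr0n // (ler_nat _ 2).
  by rewrite /t; set v := k.+2%:R^-1; lra.
have tlt k : t k < 1 by rewrite /t gtrBl.
have t0 k : 0 < t k by have := thalf k; lra.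
have tq0 k i : 0 < t k * q i by rewrite mulr_gt0.
have /choice[lamX HX] k : exists lx : R * (I -> R),
    (forall a, 0 < lx.2 a) /\ eigen S (fun i => t k * q i) lx.1 lx.2.
  have [|lam [x [x0 ex]]] := positive_eigen (perron_scaled (t0 k) pr) _ ser.
    by rewrite rho1 mulr1.
  by exists (lam, x).
pose lamk k := (lamX k).1; pose X k := (lamX k).2.
have X0 k a : 0 < X k a by have [h _] := HX k; exact: h.
have X0' k a : 0 <= X k a by exact: ltW.
have eX k : eigen S (fun i => t k * q i) (lamk k) (X k) by case: (HX k).
have X1 k a : X k a <= 1 by exact: normalized_le1 (tq0 k) (X0' k) (eX k).2.
have lamE k : lamk k = value S (X k) by exact: eigen_value (tq0 k) (X0' k) (eX k) i0.
have lam0 k : 0 < lamk k by exact: eigen_gt0 ser (tq0 k) (X0 k) (eX k) a0.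
pose r k := (t k)^-1.
have r1 k : 1 <= r k by rewrite /r invf_ge1 // ltW.
have expE k i : (t k * q i)^-1 = (q i)^-1 * r k by rewrite /r invfM mulrC.
have [U [UU Uoo]] := @ultraFilterLemma nat \oo _.
have FU : ProperFilter U by exact: ultra_proper.
have rcvg : r k @[k --> U] --> (1 : R).
  have h : t k @[k --> \oo] --> (1 : R).
    rewrite -[X in _ --> X]subr0; apply: cvgB; first exact: cvg_cst.
    by have := @cvg_harmonic R; rewrite -(cvg_shiftS (@harmonic R)).
  rewrite -[X in _ --> X]invr1; apply: cvgV; first exact: oner_neq0.
  exact: cvg_trans (cvg_app _ Uoo) h.
have /choice[u Xu] a : exists l : R, X k a @[k --> U] --> l.
  by apply: (@ultra_cvg R nat U _ 0 1) => // k; rewrite X0' X1.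
have u0 a : 0 <= u a.
  apply: (ler_cvg_to (@cvg_cst _ (0 : R) _ U _) (Xu a)).
  by apply: (@filterE _ U) => k.
have powX a : X k a `^ ((q (bid a))^-1 * r k) @[k --> U] --> u a `^ (q (bid a))^-1.
  have qi0 : 0 < (q (bid a))^-1 by rewrite invr_gt0.
  have h1 : X k a `^ (q (bid a))^-1 @[k --> U] --> u a `^ (q (bid a))^-1.
    exact: powR_cvg.
  have h2 : X k a `^ (q (bid a))^-1 - (r k - 1) @[k --> U] --> u a `^ (q (bid a))^-1.
    rewrite -[X in _ --> X]subr0 -[X in _ - X](subrr (1 : R)).
    by apply: cvgB => //; apply: cvgB => //; exact: cvg_cst.
  apply: squeeze_cvgr h2 h1; apply: (@filterE _ U) => k.
  rewrite powRrM; have := @powR_near_self R (X k a `^ (q (bid a))^-1) (r k) _ (r1 k).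
  case/(_ _)/andP; last lra.
  have e1 : (1 : R) `^ (q (bid a))^-1 = 1 by rewrite powR1.
  rewrite powR_ge0 /= -[leRHS]e1.
  by rewrite ge0_ler_powR ?nnegrE // ltW.
have lamcvg : lamk k @[k --> U] --> value S u.
  rewrite (_ : lamk = fun k => value S (X k)); last exact/funext.
  exact: value_cvg.
have eu : eigen S q (value S u) u.
  split=> [a|i].
    apply: (cvg_unique (@Rhausdorff R) (grad_cvg FU Xu)).
    rewrite (_ : (fun k => _) = fun k => lamk k * X k a `^ ((q (bid a))^-1 * r k)).
      exact: cvgM.
    by apply/funext => k; rewrite (eX k).1 expE.
  apply: (cvg_unique (@Rhausdorff R) _ (@cvg_cst _ (1 : R) _ U _)).
  rewrite (_ : (fun k => _) = fun k =>
      \sum_(a | bid a == i) X k a * X k a `^ ((q (bid a))^-1 * r k)).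
    apply: cvg_big => [|a /eqP ai]; first exact: add_continuous.
    rewrite powRD ?powRr1 // -?ai; last first.
      by apply/implyP; rewrite gt_eqF // addr_gt0 // invr_gt0.
    exact: cvgM.
  apply/funext => k; rewrite -((eX k).2 i); apply: eq_bigr => a /eqP ai.
  rewrite powRD ?powRr1 // ?expE ?ai //.
  by rewrite (gt_eqF (X0 k a)) implybT.
exists (value S u), u; split=> //; first exact: value_ge0.
- move=> eps eps0.
  have [k lk] : exists k, lamk k <= value S u + eps.
    have /cvgrPdist_lt/(_ _ eps0)/filter_ex[k] := lamcvg.
    by rewrite ltr_norml => /andP[h _]; exists k; lra.
  pose d := log_normalizer S q (X k).
  exists (scale S d (X k)), (fun i => expR (q i * rest S d i - d i) * lamk k `^ q i).
  split=> //; [exact: scale_gt0|exact: normalize| | |].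
  + by move=> i; rewrite mulr_gt0 ?expR_gt0 // powR_gt0.
  + move=> a; rewrite Fq_scale // /scale.
    rewrite mulrACA -expRD subrK ler_wpM2l ?expR_ge0 //.
    rewrite /Fq (eX k).1 powRM ?powR_ge0 ?(ltW (lam0 k)) // ler_wpM2l ?powR_ge0 //.
    rewrite expE -powRrM mulrAC mulVf ?gt_eqF // mul1r ge1r_powR //.
    by rewrite X0 X1.
  + apply: le_trans lk; rewrite prod_powR; last first.
      by move=> i; rewrite mulr_gt0 ?expR_gt0 // powR_gt0.
    under eq_bigr => i _.
      rewrite lnM ?posrE ?expR_gt0 ?powR_gt0 // expRK ln_powR mulrDr mulrBr mulrA.
      over.
    rewrite big_split sumrB /= wA rho1 mul1r subrr add0r.
    by rewrite -mulr_suml wq mul1r lnK ?posrE.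
- case=> [//|irr a].
  have [|K HK] := ratio_bound pr _ ser irr; first by rewrite rho1.
  have ue b : bid b = bid a -> u b <= expR K * u a.
    move=> ba; apply: (ler_cvg_to (Xu b) (cvgM (cvg_cst (expR K)) (Xu a))).
    apply: (@filterE _ U) => k.
    have := HK (t k) _ _ _ (X0 k) (eX k) _ _ ba.
    rewrite thalf (ltW (tlt k)) => /(_ isT) h.
    change (X k b <= expR K * X k a).
    rewrite -ler_ln ?posrE ?mulr_gt0 ?expR_gt0 // lnM ?posrE ?expR_gt0 // expRK.
    by rewrite -lerBlDr.
  have [b ba ub] := normalized_neq0 (bid a) q0 u0 eu.2.
  by have := lt_le_trans ub (ue b ba); rewrite pmulr_rgt0 // expR_gt0.
Qed.

End Existence.

(** * Strong irreducibility and growth of iterates *)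

Section Irreducibility.
Context {R : realType} {D P I E : finType} (S : system R D P I E).
Local Notation bid := (bid S).

Definition strongly_irreducible_system : Prop :=
  forall x : I -> R, (forall a, 0 <= x a) ->
    (forall i, exists2 a, bid a = i & x a != 0) -> (exists a, x a = 0) ->
    exists a, x a = 0 /\ 0 < grad S x a.

(** If no edge leaves J, then an entry of positive weight with an index of J in
some slot has all its indices in J.  Therefore the complement of J meets every
block, and the indicator of this complement violates strong irreducibility: its
gradient vanishes on J. *)
Lemma strong_irreducible : serial S -> strongly_irreducible_system ->
  irreducible_system S.
Proof.
move=> ser str J J0 JT; apply: contrapT => no.
have closed e i j : 0 < wt S e -> pos S e (slot S i) \in J -> pos S e j \in J.
  move=> we eJ; have [->//|ji] := eqVneq j (slot S i).
  apply: contrapT => /negP ejJ; apply: no.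
  exists (pos S e (slot S i)), (pos S e j); split=> //.
  by exists e, j; rewrite bid_pos blk_slot.
pose x a : R := (a \notin J)%:R.
have [b bJ] : exists b, b \notin J.
  apply: contrapT => nb; move/eqP: JT; apply; apply/setP => a.
  by rewrite finset.in_setT; apply: contrapT => /negP aJ; apply: nb; exists a.
have [a aJ] : exists a, a \in J by apply/set0Pn.
have [||| a1 [xa1]] := str x.
- by move=> a1; rewrite /x ler0n.
- move=> i; have [_ [e [_ [we eb _ _]]]] := ser b.
  exists (pos S e (slot S i)); first by rewrite bid_pos blk_slot.
  rewrite /x pnatr_eq0 eqb0 negbK; apply: contra bJ => eJ.
  by rewrite -eb (closed _ i).
- by exists a; rewrite /x aJ.
have a1J : a1 \in J by move/eqP: xa1; rewrite /x pnatr_eq0 eqb0 negbK.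
rewrite /grad big1 ?ltxx // => e /eqP ea1.
have [we|] := ltP 0 (wt S e); last first.
  by move=> we; rewrite (_ : wt S e = 0) ?mul0r //; apply/eqP; rewrite eq_le we wt_ge0.
have [_ [_ [j [_ _ jn _]]]] := ser a1.
rewrite (bigD1 j) //= /x (closed e (bid a1)) ?ea1 // mul0r mulr0 //.
Qed.

End Irreducibility.

Section Growth.
Context {R : realType} {D P I E : finType} (S : system R D P I E).
Implicit Types (x y z u : I -> R) (delta q w c B : D -> R) (a : I) (i : D) (e : E).
Local Notation bid := (bid S).

Definition block_norm q x i : R :=
  (\sum_(a | bid a == i) x a `^ (1 + (q i)^-1)) `^ (1 + (q i)^-1)^-1.

Lemma block_norm_ge0 q x i : 0 <= block_norm q x i.
Proof. exact: powR_ge0. Qed.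

Lemma block_norm_scale q delta x i : (forall i, 0 < q i) -> (forall a, 0 <= x a) ->
  normalized S q x -> block_norm q (scale S delta x) i = expR (delta i).
Proof.
move=> q0 x0 nx; have p0 : 0 < 1 + (q i)^-1 by rewrite addr_gt0 // invr_gt0.
rewrite /block_norm.
have -> : \sum_(a | bid a == i) scale S delta x a `^ (1 + (q i)^-1) =
   expR (delta i * (1 + (q i)^-1)) * \sum_(a | bid a == i) x a `^ (1 + (q i)^-1).
  rewrite mulr_sumr; apply: eq_bigr => a /eqP ai.
  by rewrite /scale powRM ?expR_ge0 // ai -expRM.
rewrite nx mulr1.
by rewrite -expRM mulfK // gt_eqF.
Qed.

Lemma block_norm_le q x y i : (forall i, 0 < q i) -> (forall a, 0 <= x a) ->
  (forall a, x a <= y a) -> block_norm q x i <= block_norm q y i.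
Proof.
move=> q0 x0 xy; have p0 : 0 < 1 + (q i)^-1 by rewrite addr_gt0 // invr_gt0.
have y0 a : 0 <= y a by exact: le_trans (xy a).
rewrite /block_norm ge0_ler_powR ?invr_ge0 ?nnegrE ?(ltW p0) //.
- by apply: sumr_ge0 => *; exact: powR_ge0.
- by apply: sumr_ge0 => *; exact: powR_ge0.
- by apply: ler_sum => a _; rewrite ge0_ler_powR ?nnegrE ?(ltW p0).
Qed.

Lemma iter_Fq_ge0 q k z : (forall a, 0 <= z a) -> forall a, 0 <= iter k (Fq S q) z a.
Proof. by case: k => [|k] z0 a //=; exact: Fq_ge0. Qed.

(** One application of F replaces delta by A delta + ln B, which increases the
w-weighted sum of delta by that of ln B when rho = 1. *)
Lemma growth_upper q w c x B M : perron_data S q 1 w c ->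
  (forall a, 0 < x a) -> normalized S q x -> (forall i, 0 < B i) ->
  (forall a, Fq S q x a <= B (bid a) * x a) ->
  exists2 C, 0 < C & forall z, (forall a, 0 <= z a) -> (forall a, z a <= M a) ->
    forall k, \prod_i block_norm q (iter k (Fq S q) z) i `^ w i <=
              C * (\prod_i B i `^ w i) ^+ k.
Proof.
move=> [q0 w0 c0 wA Ac] x0 nx B0 FB.
have x0' a : 0 <= x a by exact: ltW.
pose L := \sum_a `|M a| / x a.
exists (expR (\sum_i w i * L)); first exact: expR_gt0.
move=> z z0 zM k.
suff [delta [zd sd]] : exists delta,
    (forall a, iter k (Fq S q) z a <= scale S delta x a) /\
    \sum_i w i * delta i = \sum_i w i * L + k%:R * \sum_i w i * ln (B i).
  rewrite (prod_powR w B0) -expRM_natl -expRD -sd expR_sum; apply: ler_prod => i _.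
  rewrite powR_ge0 /= mulrC expRM ge0_ler_powR ?nnegrE ?expR_ge0 ?block_norm_ge0 //.
    exact: ltW.
  rewrite -(block_norm_scale delta i q0 x0' nx) block_norm_le //.
  exact: iter_Fq_ge0.
elim: k => [|k [delta [zd sd]]].
  exists (fun=> L); rewrite mul0r addr0; split=> // a /=.
  apply: le_trans (zM a) _; rewrite /scale -ler_pdivrMr //.
  apply: le_trans (_ : L <= _).
    apply: le_trans (_ : `|M a| / x a <= _).
      by rewrite ler_pM2r ?invr_gt0 // ler_norm.
    rewrite /L (bigD1 a) //= lerDl; apply: sumr_ge0 => b _.
    by rewrite divr_ge0.
  by have := @expR_ge1Dx R L; lra.
exists (fun i => q i * rest S delta i + ln (B i)); split=> [a|].
  rewrite iterS; apply: le_trans (_ : Fq S q (scale S delta x) a <= _).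
    by apply: Fq_le => //; exact: iter_Fq_ge0.
  rewrite Fq_scale // /scale expRD lnK ?posrE // -mulrA.
  by rewrite ler_wpM2l ?expR_ge0.
under eq_bigr do rewrite mulrDr.
rewrite big_split /= wA mul1r sd -natr1; ring.
Qed.

(** The computation of [growth_upper] is exact on an eigenvector. *)
Lemma growth_eigen q w c lam u k : perron_data S q 1 w c ->
  (forall a, 0 <= u a) -> 0 < lam -> eigen S q lam u ->
  \prod_i block_norm q (iter k (Fq S q) u) i `^ w i =
    (lam `^ (\sum_i w i * q i)) ^+ k.
Proof.
move=> [q0 w0 c0 wA Ac] u0 l0 eu.
suff [delta [-> sd]] : exists delta,
    iter k (Fq S q) u = scale S delta u /\
    \sum_i w i * delta i = k%:R * (ln lam * (\sum_i w i * q i)).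
  rewrite -[in RHS](lnK (x:=lam)) ?posrE // -expRM -expRM_natl -sd expR_sum.
  apply: eq_bigr => i _; rewrite block_norm_scale //; last by case: eu.
  by rewrite -expRM mulrC.
elim: k => [|k [delta [zd sd]]].
  exists (fun=> 0); split.
    by apply/funext => a; rewrite /scale expR0 mul1r.
  by rewrite mul0r big1 // => i _; rewrite mulr0.
exists (fun i => q i * rest S delta i + q i * ln lam); split.
  rewrite iterS zd; apply/funext => a.
  rewrite Fq_scale // (eigen_Fq q0 (ltW l0) u0 eu) /scale expRD -mulrA.
  by rewrite [q _ * ln _]mulrC [expR (ln _ * _)]expRM lnK ?posrE.
under eq_bigr do rewrite mulrDr.
rewrite big_split /= wA mul1r sd -natr1 mulrDl mul1r; congr (_ + _).
rewrite mulr_sumr; apply: eq_bigr => i _; ring.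
Qed.

End Growth.

Section Roots.
Context {R : realType}.

(** The constant C disappears after extraction of k-th roots. *)
Lemma root_upper (lam tau eps : R) (s : nat -> R) : 0 < tau -> 0 <= lam ->
  (forall k, 0 <= s k) -> 0 < eps ->
  (forall eps, 0 < eps -> exists2 C, 0 < C & forall k,
     s k <= C * ((lam + eps) `^ tau^-1) ^+ k) ->
  \forall k \near \oo, s k `^ (tau / k%:R) <= lam + eps.
Proof.
move=> t0 l0 s0 e0 /(_ (eps / 2)) [|C C0 hC]; first by rewrite divr_gt0.
(* Half of eps absorbs the k-th root of C. *)
set mu := lam + eps / 2 in hC; have mu0 : 0 < mu by rewrite /mu; lra.
have h0 : 0 < ln ((lam + eps) / mu) by rewrite ln_gt0 // ltr_pdivlMr // /mu; lra.
near=> k.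
have k0 : 0 < k%:R :> R by rewrite ltr0n; near: k; exists 1%N.
have hk : tau * `|ln C| / ln ((lam + eps) / mu) <= k%:R.
  by near: k; exact: nbhs_infty_ger.
apply: le_trans (_ : (C * (mu `^ tau^-1) ^+ k) `^ (tau / k%:R) <= _).
  rewrite ge0_ler_powR ?nnegrE ?s0 ?hC ?divr_ge0 ?(ltW t0) ?(ltW k0) //.
  by rewrite mulr_ge0 ?exprn_ge0 ?powR_ge0 // ltW.
have le0 : 0 < lam + eps by lra.
have pos0 : 0 < C * (mu `^ tau^-1) ^+ k by rewrite mulr_gt0 // exprn_gt0 // powR_gt0.
rewrite -ler_ln ?posrE ?powR_gt0 // ln_powR lnM ?posrE ?exprn_gt0 ?powR_gt0 //.
rewrite lnXn ?powR_gt0 // ln_powR -[_ * ln mu *+ _]mulr_natl.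
have -> : tau / k%:R * (ln C + k%:R * (tau^-1 * ln mu)) = tau * ln C / k%:R + ln mu.
  by field; rewrite !gt_eqF.
rewrite -lerBrDr -ln_div ?posrE // ler_pdivrMr // [leRHS]mulrC -ler_pdivrMr //.
apply: le_trans hk; rewrite ler_pM2r ?invr_gt0 // ler_pM2l //; exact: ler_norm.
Unshelve. all: by end_near. Qed.

Lemma root_lower (lam tau s : R) k : 0 < tau -> 0 <= lam -> (0 < k)%N ->
  (lam `^ tau^-1) ^+ k <= s -> lam <= s `^ (tau / k%:R).
Proof.
move=> t0 l0 k0 hs; have k0' : 0 < k%:R :> R by rewrite ltr0n.
have -> : lam = ((lam `^ tau^-1) ^+ k) `^ (tau / k%:R).
  rewrite -powR_mulrn ?powR_ge0 // -!powRrM.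
  by rewrite (_ : _ * _ = 1) ?powRr1 //; field; rewrite !gt_eqF.
rewrite ge0_ler_powR ?nnegrE ?divr_ge0 ?exprn_ge0 ?powR_ge0 ?(ltW t0) ?(ltW k0') //.
by rewrite (le_trans _ hs) // exprn_ge0 // powR_ge0.
Qed.

Lemma limn_esup_ub (s : nat -> \bar R) (l : \bar R) :
  (\forall k \near \oo, (s k <= l)%E) -> (limn_esup s <= l)%E.
Proof.
move=> h; apply: (@le_trans _ _ (ereal_sup (s @` [set k | (s k <= l)%E]))).
  by apply: ereal_inf_lbound; exists [set k | (s k <= l)%E].
by apply: ge_ereal_sup => _ [k kl <-].
Qed.

Lemma limn_esup_lb (s : nat -> \bar R) (l : \bar R) :
  (\forall k \near \oo, (l <= s k)%E) -> (l <= limn_esup s)%E.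
Proof.
move=> h; apply: le_ereal_inf_tmp => _ [V VF <-].
have [k [Vk lk]] := filter_ex (filterI VF h).
by apply: le_trans lk _; apply: ereal_sup_ubound; exists k.
Qed.

End Roots.

(** * The homogeneity matrix and its weights *)

Section Spectral.
Context {R : realType}.
Local Notation normc := ComplexField.Normc.normc.

Lemma normc_sum (I : finType) (f : I -> R[i]) :
  normc (\sum_i f i) <= \sum_i normc (f i).
Proof.
apply: (big_ind2 (fun (z : R[i]) (t : R) => normc z <= t)) => //.
  by rewrite ComplexField.Normc.normc0.
move=> z1 t1 z2 t2 h1 h2; apply: le_trans (le_normcD z1 z2) _.
exact: lerD.
Qed.

Lemma normc_ge0 (z : R[i]) : 0 <= normc z.
Proof. by case: z => a b; exact: sqrtr_ge0. Qed.

Lemma normc_real (t : R) : normc (real_complex R t) = `|t|.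
Proof. by rewrite /ComplexField.Normc.normc /= expr0n addr0 sqrtr_sqr. Qed.

(** A positive left eigenvector shows that rho is an eigenvalue; pairing the
moduli of an arbitrary complex eigenvector with a positive right eigenvector
bounds every eigenvalue by rho. *)
Lemma spectral_radius_positive d (A : 'M[R]_d) (rho : R) (b c : 'cV[R]_d) :
  (0 < d)%N -> (forall i j, 0 <= A i j) -> 0 <= rho ->
  (forall i, 0 < b i 0) -> (forall i, 0 < c i 0) ->
  A^T *m b = rho *: b -> A *m c = rho *: c -> spectral_radius A = rho.
Proof.
move=> d0 A0 r0 b0 c0 Ab Ac.
set Z := [set normc z | z in [set z : R[i] | eigenvalue (map_mx (real_complex R) A) z]].
have rZ : Z rho.
  exists (real_complex R rho); last by rewrite normc_real ger0_norm.
  apply/eigenvalueP; exists (map_mx (real_complex R) b^T).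
    rewrite -map_mxM -[b^T *m A]trmxK trmx_mul trmxK Ab linearZ /=.
    by rewrite map_mxZ.
  apply/negP => /eqP/matrixP/(_ 0 (Ordinal d0)); rewrite !mxE.
  move=> /(congr1 (@ComplexField.Normc.normc R));
  rewrite normc_real ComplexField.Normc.normc0 gtr0_norm // => /eqP.
  by rewrite gt_eqF.
have ubZ : ubound Z rho.
  move=> _ [z /eigenvalueP[v vA v0] <-].
  have key k : normc z * normc (v 0 k) <= \sum_i normc (v 0 i) * A i k.
    have /matrixP/(_ 0 k) := vA; rewrite !mxE => vk.
    rewrite -ComplexField.Normc.normcM -vk; apply: le_trans (normc_sum _) _.
    apply: ler_sum => i _.
    by rewrite mxE ComplexField.Normc.normcM normc_real ger0_norm.
  have s0 : 0 < \sum_k normc (v 0 k) * c k 0.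
    have [k vk] : exists k, v 0 k != 0.
      apply: contrapT => no; move/eqP: v0; apply; apply/rowP => k; rewrite mxE.
      by apply: contrapT => /eqP vk; apply: no; exists k.
    rewrite (bigD1 k) //= ltr_pwDl //.
      rewrite mulr_gt0 // lt_def normc_ge0 andbT; apply: contra vk => /eqP.
      by move/ComplexField.Normc.eq0_normc ->.
    by apply: sumr_ge0 => i _; rewrite mulr_ge0 ?normc_ge0 // ltW.
  rewrite -(ler_pM2r s0) mulr_sumr.
  apply: le_trans (_ : \sum_k (\sum_i normc (v 0 i) * A i k) * c k 0 <= _).
    by apply: ler_sum => k _; rewrite mulrA ler_wpM2r ?key // ltW.
  under eq_bigr do rewrite mulr_suml.
  rewrite exchange_big /= mulr_sumr; apply: ler_sum => i _.
  have /matrixP/(_ i 0) := Ac; rewrite !mxE => Aci.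
  rewrite mulrCA -Aci mulr_sumr; apply: ler_sum => k _; by rewrite mulrA.
apply/eqP; rewrite eq_le; apply/andP; split.
  by apply: ge_sup => //; exists rho.
by apply: ub_le_sup => //; exists rho.
Qed.

Lemma perron_root d (q : 'I_d -> R) (n : 'I_d -> nat) : (0 < d)%N ->
  (forall i, 0 < q i) -> (forall i, 0 < n i)%N ->
  exists2 rho, 0 <= rho & \sum_i q i * (n i)%:R / (rho + q i) = 1.
Proof.
move=> d0 q0 n0.
have n0' i : 0 < (n i)%:R :> R by rewrite ltr0n.
(* The absolute value makes f continuous on the whole line. *)
pose f (t : R) := \sum_i q i * (n i)%:R / (`|t| + q i).
pose B := \sum_i q i * (n i)%:R.
have B0 : 0 < B.
  rewrite /B (bigD1 (Ordinal d0)) //= ltr_pwDl ?mulr_gt0 //.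
  by apply: sumr_ge0 => i _; rewrite mulr_ge0 // ltW.
have den0 t i : 0 < `|t| + q i by rewrite ltr_wpDl.
have f0 : 1 <= f 0.
  rewrite /f (bigD1 (Ordinal d0)) //= normr0 add0r mulrAC mulfV ?gt_eqF // mul1r.
  rewrite ler_wpDr ?ler1n ?n0 //.
  apply: sumr_ge0 => i _; rewrite divr_ge0 ?mulr_ge0 ?(ltW (q0 i)) //.
  by rewrite ?add0r ltW.
have fB : f B <= 1.
  have <- : B / B = 1 by rewrite divff // gt_eqF.
  rewrite /f [leRHS]mulr_suml; apply: ler_sum => i _.
  by rewrite ler_pM2l ?mulr_gt0 // lef_pV2 ?posrE // gtr0_norm // lerDl ltW.
have cf : {within `[0, B], continuous f}.
  apply: continuous_subspaceT => t; rewrite /f.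
  apply: cvg_big => [|i _]; first exact: add_continuous.
  apply: cvgM; first exact: cvg_cst.
  apply: cvgV; first by rewrite gt_eqF.
  apply: cvgD; last exact: cvg_cst.
  exact: norm_continuous.
have [|c] := @IVT R f 0 B 1 (ltW B0) cf.
  by rewrite ge_min fB orbT le_max f0.
rewrite in_itv /= => /andP[c0 _] fc; exists c => //.
rewrite -[RHS]fc /f; apply: eq_bigr => i _.
rewrite (ger0_norm c0).
done.
Qed.

Section Amatrix.
Context {m : nat} {N : 'I_m -> nat} {d : nat} (sigma : shape_partition N d).
Context (p : 'I_d -> R) (hp : forall i, 1 < p i).

Definition qexp (i : 'I_d) : R := conjexp (p i) - 1.

Local Notation q := qexp.

Lemma qexpE i : q i = (p i - 1)^-1.
Proof. by have := hp i; rewrite /qexp /conjexp => h; field; lra. Qed.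

Lemma qexp_gt0 i : 0 < q i.
Proof. by rewrite qexpE invr_gt0 subr_gt0. Qed.

Lemma addr_qexpV i : 1 + (q i)^-1 = p i.
Proof. by rewrite qexpE invrK addrC subrK. Qed.

Lemma AmatrixE i k :
  Amatrix sigma p i k = q i * ((nu sigma k)%:R - (i == k)%:R).
Proof.
rewrite /Amatrix mul_diag_mx !mxE; congr (_ * (_ - _)).
by rewrite big_ord_recl big_ord0 !mxE mul1r addr0.
Qed.

Lemma nu_gt0 i : (0 < nu sigma i)%N.
Proof. by rewrite /nu card_gt0 block_neq0. Qed.

(** The equation satisfied by rho makes nu_i / (rho + q_i) and
q_i / (rho + q_i) left and right eigenvectors. *)
Lemma Amatrix_perron : (0 < d)%N ->
  [/\ 0 <= spectral_radius (Amatrix sigma p),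
      is_weight sigma p (bweight sigma p) &
      exists2 c : 'cV[R]_d, (forall i, 0 < c i 0) &
        Amatrix sigma p *m c = spectral_radius (Amatrix sigma p) *: c].
Proof.
move=> d0.
have q0 := qexp_gt0.
have [rho r0 root] := perron_root d0 q0 nu_gt0.
have rq0 i : 0 < rho + q i by rewrite ltr_wpDl.
have n0 i : 0 < (nu sigma i)%:R :> R by rewrite ltr0n nu_gt0.
pose b : 'cV[R]_d := \col_i ((nu sigma i)%:R / (rho + q i)).
pose c : 'cV[R]_d := \col_i (q i / (rho + q i)).
have b0 i : 0 < b i 0 by rewrite mxE divr_gt0.
have c0 i : 0 < c i 0 by rewrite mxE divr_gt0.
have Ab : (Amatrix sigma p)^T *m b = rho *: b.
  apply/colP => k; rewrite !mxE.
  under eq_bigr => i _ do rewrite mxE AmatrixE mulrBr mulrBl.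
  have diag : \sum_i q i * (i == k)%:R * b i 0 = q k * b k 0.
    rewrite (bigD1 k) //= eqxx mulr1 big1 ?addr0 // => i /negPf ->.
    by rewrite mulr0 mul0r.
  rewrite sumrB diag.
  have -> : \sum_i q i * (nu sigma k)%:R * b i 0 =
      (nu sigma k)%:R * \sum_i q i * (nu sigma i)%:R / (rho + q i).
    rewrite mulr_sumr; apply: eq_bigr => i _; rewrite mxE; ring.
  rewrite root mxE; field; rewrite gt_eqF //.
have Ac : Amatrix sigma p *m c = rho *: c.
  apply/colP => i; rewrite !mxE.
  under eq_bigr => k _ do rewrite AmatrixE mulrBr mulrBl.
  have diag : \sum_k q i * (i == k)%:R * c k 0 = q i * c i 0.
    rewrite (bigD1 i) //= eqxx mulr1 big1 ?addr0 // => k ki.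
    by rewrite eq_sym (negPf ki) mulr0 mul0r.
  rewrite sumrB diag.
  have -> : \sum_k q i * (nu sigma k)%:R * c k 0 =
      q i * \sum_k q k * (nu sigma k)%:R / (rho + q k).
    rewrite mulr_sumr; apply: eq_bigr => k _; rewrite mxE; ring.
  rewrite root mxE; field; rewrite gt_eqF //.
have A0 i k : 0 <= Amatrix sigma p i k.
  rewrite AmatrixE mulr_ge0 ?(ltW (q0 i)) // subr_ge0.
  apply: le_trans (_ : 1 <= _); first by case: (_ == _).
  by rewrite ler1n nu_gt0.
have sr : spectral_radius (Amatrix sigma p) = rho.
  exact: (spectral_radius_positive d0 A0 r0 b0 c0).
split; [by rewrite sr| |by exists c; rewrite ?sr].
have s0 : 0 < \sum_i b i 0.
  rewrite (bigD1 (Ordinal d0)) //= ltr_pwDl //.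
  by apply: sumr_ge0 => i _; exact: ltW.
rewrite /bweight; apply: (@xgetPex _ (0 : 'cV[R]_d) [set b | is_weight sigma p b]).
exists ((\sum_i b i 0)^-1 *: b); split.
- by move=> i; rewrite mxE mulr_gt0 // invr_gt0.
- by rewrite -scalemxAr Ab sr !scalerA mulrC.
- under eq_bigr do rewrite mxE.
  by rewrite -mulr_sumr mulVf // gt_eqF.
Qed.

End Amatrix.
End Spectral.

(** * From tensors to hypergraph systems *)

Section Partial.
Context {R : realType}.

(** All partial derivatives below are derivatives of explicit polynomials in one
entry. *)
Lemma derive1_poly (f : R -> R) (P : {poly R}) (t : R) :
  (forall s, f s = P.[s]) -> derive1 f t = P^`().[t].
Proof.
move=> fP; have -> : f = horner P by apply/funext.
by rewrite derive1E; apply: derive_val.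
Qed.

Context {m : nat} {N : 'I_m -> nat}.

Lemma set_entry_same (z : blockvec R N) (a : bindex N) t :
  set_entry z a t (tag a) 0 (tagged a) = t.
Proof. by rewrite /set_entry dfwithin mxE eqxx. Qed.

Lemma set_entryE (z : blockvec R N) (a b : bindex N) t :
  entry (set_entry z a t) b = if b == a then t else entry z b.
Proof.
have [->|ba] := eqVneq b a; first exact: set_entry_same.
rewrite /entry /set_entry; case: a ba => i l; case: b => j k /=.
move=> jk; have [ij|ij] := eqVneq i j; last by rewrite dfwithout.
subst j; rewrite dfwithin mxE; case: eqVneq => // kl.
by move: jk; rewrite kl eqxx.
Qed.

Lemma tgradE (T : tensor R N) (a : bindex N) (z : blockvec R N) :
  tgrad T a z = \sum_(K : {dffun forall j : 'I_m, 'I_(N j)} | K (tag a) == tagged a)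
    T K * \prod_(j | j != tag a) z j 0 (K j).
Proof.
case: a => i l; rewrite /tgrad /partial /=.
pose P : {poly R} :=
  \sum_(K : {dffun forall j : 'I_m, 'I_(N j)}) (T K * \prod_(j | j != i) z j 0 (K j)) *:
    (if K i == l then 'X else (z i 0 (K i))%:P).
rewrite (@derive1_poly _ P); last first.
  move=> s; rewrite /tform /P horner_sum; apply: eq_bigr => K _.
  rewrite hornerZ -mulrA; congr (_ * _).
  rewrite [LHS](bigD1 i) //= [LHS]mulrC; congr (_ * _).
    apply: eq_bigr => j ja.
    have := set_entryE z (Tagged (fun j => 'I_(N j)) l) (Tagged (fun j => 'I_(N j)) (K j)) s.
    by rewrite /entry /= -tag_eqE /tag_eq /= (negPf ja).
  have := set_entryE z (Tagged (fun j => 'I_(N j)) l) (Tagged (fun j => 'I_(N j)) (K i)) s.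
  rewrite /entry /= => ->; rewrite eq_Tagged /=.
  by case: ifP => _; rewrite ?hornerX ?hornerC.
rewrite /P raddf_sum horner_sum [RHS]big_mkcond /=; apply: eq_bigr => K _.
rewrite derivZ hornerZ; case: ifP => _; first by rewrite derivX hornerC mulr1.
by rewrite derivC horner0 mulr0.
Qed.

End Partial.

Section TensorSystem.
Context {R : realType} {m : nat} {N : 'I_m -> nat} (hN : forall j, (0 < N j)%N).
Context (T : tensor R N) (hT : forall J, 0 <= T J).
Context {d : nat} (sigma : shape_partition N d).
Local Notation n := (bdim sigma).

Lemma block_of_unique i j : j \in sigma i -> block_of sigma j = i.
Proof.
move=> ji; have /and3P[_ /finset.trivIsetP tI _] := block_partition sigma.
apply: contrapT => /eqP ne.
have := tI (sigma (block_of sigma j)) (sigma i) (imset_f _ isT) (imset_f _ isT).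
rewrite (inj_eq (@block_inj _ _ _ sigma)) => /(_ ne) /pred0P /(_ j) /=.
by rewrite block_ofP ji.
Qed.

Lemma block_of_smin i : block_of sigma (smin sigma i) = i.
Proof. exact/block_of_unique/smin_in. Qed.

Definition tpos (K : {dffun forall j : 'I_m, 'I_(N j)}) (j : 'I_m) : bindex n :=
  Tagged (fun i => 'I_(n i)) (cast_ord (esym (bdim_block_of sigma j)) (K j)).

Lemma bindex_surj i : exists a : bindex n, tag a = i.
Proof. by exists (Tagged (fun i => 'I_(n i)) (Ordinal (hN (smin sigma i)))). Qed.

Definition tensor_system : system R 'I_d 'I_m (bindex n) {dffun forall j : 'I_m, 'I_(N j)} :=
  @System R _ _ _ _ (block_of sigma) (smin sigma) tag tpos T hT
    (fun _ _ => erefl) block_of_smin bindex_surj.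
Local Notation S := tensor_system.

Lemma expandE (x : blockvec R n) (K : {dffun forall j : 'I_m, 'I_(N j)}) j :
  Defs.expand x j 0 (K j) = entry x (tpos K j).
Proof.
rewrite /Defs.expand castmxE /entry /tpos /=.
by congr (x _ _ _); apply: val_inj.
Qed.

(** The position smin sigma i lies in block i only up to a propositional
equality of the dimensions. *)
Lemma tpos_smin (a : bindex n) (K : {dffun forall j : 'I_m, 'I_(N j)}) :
  (tpos K (smin sigma (tag a)) == a) = (K (smin sigma (tag a)) == tagged a :> 'I_(N _)).
Proof.
case: a => i l /=; rewrite /tpos.
move: (bdim_block_of _ _) (K _); rewrite block_of_smin => e k.
rewrite -tag_eqE /tag_eq /= eqxx tagged_asE -val_eqE /=.
by rewrite -[RHS]val_eqE.
Qed.

Lemma sgradE (a : bindex n) (x : blockvec R n) : sgrad T a x = grad S (entry x) a.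
Proof.
rewrite /sgrad tgradE /grad /=; apply: eq_big => [K|K _].
  by rewrite tpos_smin.
by congr (_ * _); apply: eq_bigr => j _; rewrite expandE.
Qed.

(** In the entry c alone, with all other entries equal to one, a monomial is a
power whose exponent counts the positions occupied by c. *)
Lemma Mmatrix_edge (a c : bindex n) : Mmatrix T a c != 0 <-> edge S a c.
Proof.
pose cnt (K : {dffun forall j : 'I_m, 'I_(N j)}) :=
  #|[pred j | (j != smin sigma (tag a)) && (tpos K j == c)]|.
have -> : Mmatrix T a c =
    \sum_(K | tpos K (smin sigma (tag a)) == a) T K * (cnt K)%:R.
  rewrite /Mmatrix /partial.
  rewrite (@derive1_poly _ _ (\sum_(K | tpos K (smin sigma (tag a)) == a) T K *: 'X^(cnt K))).
    rewrite raddf_sum horner_sum; apply: eq_bigr => K _.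
    by rewrite /= derivZ derivXn hornerZ hornerMn hornerXn /entry mxE expr1n.
  move=> s; rewrite sgradE horner_sum /grad /=; apply: eq_bigr => K _.
  rewrite hornerZ hornerXn; congr (_ * _).
  under eq_bigr do rewrite set_entryE /entry mxE.
  by rewrite -big_mkcondr /= prodr_const.
split=> [h|[K [j [TK Ka ja jc]]]].
  apply: contrapT => no; move/eqP: h; apply; apply: big1 => K /eqP Ka.
  have [TK|TK] := ltP 0 (T K); last first.
    by rewrite (_ : T K = 0) ?mul0r //; apply/eqP; rewrite eq_le TK hT.
  rewrite (_ : cnt K = 0%N) ?mulr0 //; apply/eqP; rewrite -leqn0 leqNgt.
  apply/negP => /card_gt0P[j]; rewrite inE => /andP[ja /eqP jc].
  by apply: no; exists K, j.
have Ka' : tpos K (smin sigma (tag a)) == a by exact/eqP.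
rewrite gt_eqF // (bigD1 K) //= ltr_pwDl //.
  rewrite mulr_gt0 // ltr0n; apply/card_gt0P; exists j.
  by rewrite inE; apply/andP; split=> //; exact/eqP.
by apply: sumr_ge0 => K' _; rewrite mulr_ge0.
Qed.

Lemma strictly_nonneg_serial : strictly_nonneg sigma T -> serial S.
Proof. by move=> h a; have [c /Mmatrix_edge] := h a; exists c. Qed.

Lemma weakly_irreducible_system : weakly_irreducible sigma T -> irreducible_system S.
Proof.
move=> h J J0 JT; have [a [b [aJ bJ /Mmatrix_edge ab]]] := h J J0 JT.
by exists a, b.
Qed.

Definition mkvec (f : bindex n -> R) : blockvec R n :=
  fun i => \row_l f (Tagged (fun i => 'I_(n i)) l).

Lemma entry_mkvec f : entry (mkvec f) = f.
Proof. by apply/funext => -[i l]; rewrite /entry mxE. Qed.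

Lemma entry_inj (x y : blockvec R n) : entry x =1 entry y -> x = y.
Proof.
move=> xy; apply: functional_extensionality_dep => i; apply/rowP => l.
exact: (xy (Tagged (fun i => 'I_(n i)) l)).
Qed.

Lemma set_entry_continuous (x : blockvec R n) a :
  continuous (set_entry x a : R -> prod_topology (fun i => 'rV[R]_(n i))).
Proof.
pose h (t : R) : 'rV[R]_(n (tag a)) :=
  x (tag a) - (x (tag a) 0 (tagged a) - t) *: delta_mx 0 (tagged a).
have -> : set_entry x a = dfwith x (tag a) \o h.
  apply/funext => t; rewrite /set_entry /=; congr (dfwith x _ _).
  apply/rowP => l; rewrite !mxE eqxx /=; case: eqVneq => [->|_] /=.
    by rewrite mulr1 opprB addrC subrK.
  by rewrite mulr0 subr0.
move=> t; apply: continuous_comp; last exact: dfwith_continuous.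
apply: cvgB; first exact: cvg_cst.
by apply: cvgZr_tmp; apply: cvgB; [exact: cvg_cst|exact: cvg_id].
Qed.

(** If some entry of an interior point vanished, lowering it would leave the
cone immediately. *)
Lemma KppP (x : blockvec R n) : Kpp x <-> forall a, 0 < entry x a.
Proof.
pose V := prod_topology (fun i => 'rV[R]_(n i)).
split=> [|x0].
  rewrite /Kpp /interior => xK a; rewrite lt_neqAle.
  have := nbhs_singleton xK a => ->; rewrite andbT; apply/eqP => xa.
  have x_set : set_entry x a 0 = x.
    by apply: entry_inj => b; rewrite set_entryE; case: eqP => // ->.
  have : \forall t \near (0 : R), Kp (set_entry x a t).
    apply: (set_entry_continuous (x := x) (a := a) (x0 := 0)).
    by rewrite x_set.
  move=> /nbhs_ballP[e /= e0 be].
  have h : ball (0 : R) e (- (e / 2)).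
    by rewrite /ball /= sub0r opprK gtr0_norm; lra.
  have := be _ h a; rewrite set_entryE eqxx; lra.
have near_pos : nbhs (x : V) [set y : V | forall a : bindex n, 0 < entry (y : blockvec R n) a].
  apply: (@filter_forall V (bindex n)
    (fun a => [set y : V | 0 < entry (y : blockvec R n) a]) (nbhs (x : V)) _) => a.
  have ce : {for (x : V), continuous ((fun v : 'rV[R]_(n (tag a)) => v 0 (tagged a)) \o
      (proj (tag a) : V -> 'rV[R]_(n (tag a))))}.
    by apply: continuous_comp; [exact: proj_continuous|exact: coord_continuous].
  apply: (ce [set t : R | 0 < t]); apply: open_nbhs_nbhs; split; first exact: open_gt.
  exact: x0.
by apply: filterS near_pos => y y0 a; exact: ltW.
Qed.

Context (p : 'I_d -> R) (hp : forall i, 1 < p i).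

Local Notation qexp := (qexp p).

Lemma sum_block (i : 'I_d) (f : bindex n -> R) :
  \sum_(a | tag a == i) f a = \sum_(l < n i) f (Tagged (fun i => 'I_(n i)) l).
Proof.
transitivity (\sum_(k | k == i) \sum_(l < n k) f (Tagged (fun i => 'I_(n i)) l)).
  rewrite (@sig_big_dep _ _ _ _ _ (pred1 i) (fun _ _ => true)
    (fun k l => f (Tagged (fun i => 'I_(n i)) l))) /=.
  by apply: eq_big => [[k l]|[k l] _] //=; rewrite andbT.
by rewrite big_pred1_eq.
Qed.

Lemma lpnorm_block (x : blockvec R n) i : Kp x ->
  lpnorm (p i) (x i) = block_norm S qexp (entry x) i.
Proof.
move=> xK; rewrite /lpnorm /block_norm (addr_qexpV hp); congr (_ `^ _).
rewrite sum_block; apply: eq_bigr => l _.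
by rewrite ger0_norm //; exact: (xK (Tagged (fun i => 'I_(n i)) l)).
Qed.

Lemma lpnorm_normalized (x : blockvec R n) : Kp x ->
  (forall i, lpnorm (p i) (x i) = 1) <-> normalized S qexp (entry x).
Proof.
move=> xK; split=> h i; have := h i; rewrite ?lpnorm_block //.
  have p0 : 0 < 1 + (qexp i)^-1 by rewrite addr_gt0 // invr_gt0 (qexp_gt0 hp).
  move=> /eqP; rewrite /block_norm powR_eq1 invr_eq0 (gt_eqF p0) orbF.
  rewrite ltNge sumr_ge0 ?orbF => [/eqP //|*]; exact: powR_ge0.
by rewrite /block_norm => ->; rewrite powR1.
Qed.

Lemma psi_ge0 i (t : R) : 0 <= t -> psi (p i) t = t `^ (qexp i)^-1.
Proof.
move=> t0; rewrite /psi (qexpE hp) invrK ger0_norm //.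
have [->|tz] := eqVneq t 0.
  by rewrite sgr0 mulr0 powR0 // gt_eqF // subr_gt0.
by rewrite gtr0_sg ?mulr1 // lt_def tz.
Qed.

Lemma eigenpair_eigen lam (x : blockvec R n) : Kp x ->
  eigenpair sigma p T lam x <-> eigen S qexp lam (entry x).
Proof.
move=> xK; split=> -[h1 h2].
  split; last exact/lpnorm_normalized.
  by case=> i l; rewrite -sgradE (h1 i l) psi_ge0 //; exact: (xK (Tagged (fun i => 'I_(n i)) l)).
split; last exact/lpnorm_normalized.
by move=> i l; rewrite sgradE h1 -psi_ge0 //; exact: xK.
Qed.

Definition absv (x : blockvec R n) : blockvec R n := mkvec (fun a => `|entry x a|).

Lemma absv_Kp x : Kp (absv x).
Proof. by move=> a; rewrite entry_mkvec. Qed.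

(** The triangle inequality turns a signed eigenvector into a nonnegative vector
on which F expands by at least the modulus of the eigenvalue. *)
Lemma eigenpair_abs lam (x : blockvec R n) : eigenpair sigma p T lam x ->
  normalized S qexp (entry (absv x)) /\
  forall a, `|lam| `^ qexp (tag a) * entry (absv x) a <= Fq S qexp (entry (absv x)) a.
Proof.
move=> [ex nx]; have Ka := absv_Kp x; split.
  have absE i : lpnorm (p i) (absv x i) = lpnorm (p i) (x i).
    by congr (_ `^ _); apply: eq_bigr => l _; rewrite mxE normr_id.
  by apply/(lpnorm_normalized Ka) => i; rewrite absE.
move=> a; have q0 := qexp_gt0 hp (tag a).
have le1 : `|lam| * entry (absv x) a `^ (qexp (tag a))^-1 <= grad S (entry (absv x)) a.
  apply: le_trans (_ : `|grad S (entry x) a| <= _).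
    case: a => i l in q0 *; rewrite -sgradE (ex i l) normrM ler_wpM2l //.
    rewrite /psi normrM (@ger0_norm _ (_ `^ _)) ?powR_ge0 // entry_mkvec.
    rewrite [tag _]/= (qexpE hp) invrK /entry /=.
    have [->|xz] := eqVneq (x i 0 l) 0.
      by rewrite sgr0 normr0 mulr0 powR0 // gt_eqF // subr_gt0.
    by rewrite normr_sg xz mulr1.
  apply: le_trans (ler_norm_sum _ _ _) _; apply: ler_sum => K _.
  rewrite normrM (ger0_norm (wt_ge0 _ _)) ler_wpM2l ?wt_ge0 // normr_prod.
  by apply: ler_prod => j _; rewrite normr_ge0 entry_mkvec /=.
have x0 : 0 <= entry (absv x) a by exact: Ka.
have -> : `|lam| `^ qexp (tag a) * entry (absv x) a =
   (`|lam| * entry (absv x) a `^ (qexp (tag a))^-1) `^ qexp (tag a).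
  by rewrite powRM ?powR_ge0 // powRVK // gt_eqF.
rewrite ge0_ler_powR ?nnegrE ?(ltW q0) ?mulr_ge0 ?powR_ge0 //.
exact: grad_ge0.
Qed.

Lemma entry_Fmap (x : blockvec R n) : entry (Fmap sigma p T x) = Fq S qexp (entry x).
Proof. by apply/funext => -[i l]; rewrite /entry mxE sgradE. Qed.

Lemma entry_iter k (x : blockvec R n) :
  entry (iter k (Fmap sigma p T) x) = iter k (Fq S qexp) (entry x).
Proof. by elim: k => //= k <-; rewrite entry_Fmap. Qed.

Lemma iter_Kp k (x : blockvec R n) : Kp x -> Kp (iter k (Fmap sigma p T) x).
Proof. by move=> xK a; rewrite entry_iter; exact: iter_Fq_ge0. Qed.

Lemma wnorm_block (x : blockvec R n) : Kp x ->
  wnorm sigma p x = \prod_i block_norm S qexp (entry x) i `^ bweight sigma p i 0.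
Proof. by move=> xK; apply: eq_bigr => i _; rewrite lpnorm_block. Qed.

Lemma nuE k : nu sigma k = #|[pred j | block_of sigma j == k]|.
Proof.
apply: eq_card => j; rewrite [RHS]inE; apply/idP/eqP => [|<-].
  exact: block_of_unique.
exact: block_ofP.
Qed.

Lemma rest_nu delta i :
  rest S delta i = \sum_k (nu sigma k)%:R * delta k - delta i.
Proof.
have -> : \sum_k (nu sigma k)%:R * delta k = \sum_j delta (block_of sigma j).
  rewrite (partition_big (block_of sigma) predT) //; apply: eq_bigr => k _.
  rewrite (eq_bigr (fun=> delta k)); last by move=> j /eqP ->.
  by rewrite sumr_const mulr_natl nuE.
by rewrite (bigD1 (smin sigma i)) //= block_of_smin addrAC subrr add0r.
Qed.

End TensorSystem.

(** * Collatz-Wielandt numbers of the tensor map *)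

Section Main.
Context {R : realType} {m : nat} (hm : (0 < m)%N).
Context {N : 'I_m -> nat} (hN : forall j, (0 < N j)%N).
Context (T : tensor R N) (hT : forall J, 0 <= T J).
Context {d : nat} (sigma : shape_partition N d) (p : 'I_d -> R) (hp : forall i, 1 < p i).
Local Notation n := (bdim sigma).
Local Notation S := (tensor_system hN hT sigma).
Local Notation q := (qexp p).
Local Notation rho := (spectral_radius (Amatrix sigma p)).
Local Notation F := (Fmap sigma p T).
Local Notation b i := (bweight sigma p i 0).
Local Notation tau := (\sum_i b i * q i).
Local Notation w := (fun i => (gexp sigma p - 1) * b i).

Lemma d_gt0 : (0 < d)%N.
Proof. exact: leq_ltn_trans (ltn_ord (block_of sigma (Ordinal hm))). Qed.

Lemma is_weight_bweight : is_weight sigma p (bweight sigma p).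
Proof. by have [_ + _] := Amatrix_perron sigma hp d_gt0. Qed.

Lemma b_gt0 i : 0 < b i.
Proof. by have [+ _ _] := is_weight_bweight; apply. Qed.

Lemma tau_gt0 : 0 < tau.
Proof.
rewrite (bigD1 (Ordinal d_gt0)) //= ltr_pwDl //.
  by rewrite mulr_gt0 ?b_gt0 ?qexp_gt0.
by apply: sumr_ge0 => i _; rewrite mulr_ge0 ?(ltW (b_gt0 _)) ?(ltW (qexp_gt0 hp _)).
Qed.

(** Since the weights b have sum one, sum_i b i p_i' exceeds sum_i b i q i by
one. *)
Lemma gexpE : gexp sigma p - 1 = tau^-1.
Proof.
have [_ _ b1] := is_weight_bweight.
have -> : tau = \sum_(i < d) b i * conjexp (p i) - 1.
  by rewrite -[in RHS]b1 -sumrB; apply: eq_bigr => i _; rewrite /qexp mulrBr mulr1.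
have := tau_gt0.
have -> : tau = \sum_(i < d) b i * conjexp (p i) - 1.
  by rewrite -[in RHS]b1 -sumrB; apply: eq_bigr => i _; rewrite /qexp mulrBr mulr1.
rewrite /gexp; set s := \sum_(i < d) _ => s0.
by field; rewrite gt_eqF.
Qed.

Lemma perron_b : exists c, perron_data S q rho (fun i => b i) c.
Proof.
have [r0 [b0 Ab b1] [c c0 Ac]] := Amatrix_perron sigma hp d_gt0.
have linE delta i : q i * rest S delta i = \sum_k Amatrix sigma p i k * delta k.
  rewrite rest_nu mulrBr mulr_sumr.
  under [RHS]eq_bigr => k _ do rewrite AmatrixE mulrBr mulrBl.
  rewrite sumrB; congr (_ - _).
    by apply: eq_bigr => k _; rewrite mulrA.
  rewrite (bigD1 i) //= eqxx mulr1 big1 ?addr0 // => k ki.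
  by rewrite eq_sym (negPf ki) mulr0 mul0r.
exists (fun i => c i 0); split=> //.
- exact: qexp_gt0.
- move=> delta; under eq_bigr do rewrite linE mulr_sumr.
  rewrite exchange_big /= mulr_sumr; apply: eq_bigr => k _.
  have /matrixP/(_ k 0) := Ab; rewrite !mxE mulrA => <-.
  rewrite mulr_suml; apply: eq_bigr => i _; rewrite [_^T _ _]mxE; ring.
- move=> i; rewrite linE; have /matrixP/(_ i 0) := Ac; rewrite !mxE => <-.
  by [].
Qed.

Lemma perron_w : exists c, perron_data S q rho w c.
Proof.
have [c [q0 b0 c0 bA Ac]] := perron_b; exists c; split=> // [i|delta].
  by rewrite gexpE mulr_gt0 ?invr_gt0 ?tau_gt0.
under eq_bigr do rewrite -mulrA.
rewrite -mulr_sumr bA mulrCA; congr (_ * _); rewrite mulr_sumr.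
by apply: eq_bigr => i _; rewrite mulrA.
Qed.

Lemma w_normalized : \sum_i w i * q i = 1.
Proof.
under eq_bigr do rewrite -mulrA.
by rewrite -mulr_sumr gexpE mulVf // gt_eqF // tau_gt0.
Qed.

Lemma SpP (x : blockvec R n) : Sp p x <-> Kp x /\ normalized S q (entry x).
Proof.
by split=> -[xK h]; split=> //; apply/(lpnorm_normalized hN hT hp xK).
Qed.

Lemma ratioE (x : blockvec R n) i l :
  F x i 0 l / x i 0 l = Fq S q (entry x) (bi l) / entry x (bi l).
Proof. by rewrite -entry_Fmap. Qed.

Lemma cw_upper_bound (x : blockvec R n) : (forall a, 0 < entry x a) -> serial S ->
  exists B, [/\ forall i, 0 < B i, forall a, Fq S q (entry x) a <= B (tag a) * entry x a &
    cw_upper sigma p F x = \prod_i B i `^ w i].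
Proof.
move=> x0 ser.
pose B i := sup [set F x i 0 l / x i 0 l | l in [set: 'I_(n i)]].
have ub i : has_ubound [set F x i 0 l / x i 0 l | l in [set: 'I_(n i)]].
  exists (\sum_l F x i 0 l / x i 0 l) => _ [l _ <-].
  rewrite (bigD1 l) //= lerDl; apply: sumr_ge0 => k _.
  by rewrite ratioE divr_ge0 ?Fq_ge0 // ltW.
have le i l : F x i 0 l / x i 0 l <= B i by apply: ub_le_sup => //; exists l.
exists B; split=> //.
  move=> i; have [[k l] ki] := bindex_surj hN sigma i.
  rewrite /= in ki; subst k; apply: lt_le_trans (le i l).
  by rewrite ratioE divr_gt0 ?Fq_gt0.
case=> i l; rewrite -ler_pdivrMr //; have := le i l; by rewrite ratioE.
Qed.

Lemma cw_upper_le (x : blockvec R n) B : (forall a, 0 < entry x a) ->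
  (forall i, 0 < B i) -> (forall a, Fq S q (entry x) a <= B (tag a) * entry x a) ->
  cw_upper sigma p F x <= \prod_i B i `^ w i.
Proof.
move=> x0 B0 xB; apply: ler_prod => i _; rewrite powR_ge0 /=.
have w0 : 0 <= w i by rewrite gexpE mulr_ge0 ?invr_ge0 ?(ltW tau_gt0) ?(ltW (b_gt0 i)).
have [[k l] ki] := bindex_surj hN sigma i; rewrite /= in ki; subst k.
have le j : F x i 0 j / x i 0 j <= B i by rewrite ratioE ler_pdivrMr ?x0 // xB.
have ub : has_ubound [set F x i 0 l / x i 0 l | l in [set: 'I_(n i)]].
  by exists (B i) => _ [j _ <-].
rewrite ge0_ler_powR ?nnegrE ?(ltW (B0 i)) //.
  apply: le_trans (_ : F x i 0 l / x i 0 l <= _).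
    by rewrite ratioE divr_ge0 ?Fq_ge0 // ltW.
  by apply: ub_le_sup => //; exists l.
by apply: ge_sup => [|_ [j _ <-] //]; exists (F x i 0 l / x i 0 l); exists l.
Qed.

Lemma cw_lower_bound (y : blockvec R n) : Sp p y ->
  exists alpha, [/\ forall i, 0 <= alpha i,
    forall a, alpha (tag a) * entry y a <= Fq S q (entry y) a &
    cw_lower sigma p F y = \prod_i alpha i `^ w i].
Proof.
move=> /SpP[yK ny].
pose al i := inf [set F y i 0 l / y i 0 l | l in [set l | 0 < y i 0 l]].
have lb i : lbound [set F y i 0 l / y i 0 l | l in [set l | 0 < y i 0 l]] 0.
  by move=> _ [l yl <-]; rewrite ratioE divr_ge0 ?Fq_ge0 // ltW.
exists al; split=> // [i|[i l]].
  have [[k l] ki yl] := normalized_neq0 i (qexp_gt0 hp) yK ny.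
  rewrite /= in ki; subst k; apply: lb_le_inf => //.
  by exists (F y i 0 l / y i 0 l); exists l.
have := yK (bi l); rewrite le_eqVlt => /orP[/eqP ye|yl].
  by rewrite -[X in _ * X]ye mulr0 Fq_ge0.
rewrite -ler_pdivlMr // -ratioE; apply: ge_inf; first by exists 0; exact: lb.
by exists l.
Qed.

Lemma cw_lower_eigen lam (u : blockvec R n) : Kp u -> 0 <= lam ->
  eigen S q lam (entry u) -> cw_lower sigma p F u = lam.
Proof.
move=> uK l0 eu; have [c prw] := perron_w; have [q0 w0 _ _ _] := prw.
rewrite -[RHS](prod_powR_eigenvalue q0 w0 w_normalized l0); apply: eq_bigr => i _.
congr (_ `^ _); rewrite -[RHS]inf1; congr inf; apply/seteqP; split.
  move=> _ [l ul <-] /=; rewrite ratioE (eigen_Fq q0 l0 uK eu) /= mulfK //.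
  by rewrite gt_eqF.
move=> _ ->; have [[k l] ki ul] := normalized_neq0 i q0 uK eu.2.
rewrite /= in ki; subst k; exists l => //.
by rewrite ratioE (eigen_Fq q0 l0 uK eu) /= mulfK // gt_eqF.
Qed.

Lemma strongly_irreducibleP : strongly_irreducible sigma T ->
  strongly_irreducible_system S.
Proof.
move=> str x x0 xn [a xa]; have [|e [xe ge]] := str (mkvec x).
- split; first split.
  + by move=> b; rewrite entry_mkvec.
  + move=> i; have [[k l] ki xl] := xn i; rewrite /= in ki; subst k.
    by apply: contra xl => /eqP/rowP/(_ l); rewrite !mxE => ->.
  + by move=> /(KppP _)/(_ a); rewrite entry_mkvec xa ltxx.
by rewrite (sgradE hN hT) entry_mkvec in ge; rewrite entry_mkvec in xe; exists e.
Qed.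

End Main.

(** * The spectral radius of the tensor *)

Section Radius.
Context {R : realType} {m : nat} (hm : (0 < m)%N).
Context {N : 'I_m -> nat} (hN : forall j, (0 < N j)%N).
Context (T : tensor R N) (hT : forall J, 0 <= T J).
Context {d : nat} (sigma : shape_partition N d) (p : 'I_d -> R) (hp : forall i, 1 < p i).
Local Notation n := (bdim sigma).
Local Notation S := (tensor_system hN hT sigma).
Local Notation q := (qexp p).
Local Notation rho := (spectral_radius (Amatrix sigma p)).
Local Notation F := (Fmap sigma p T).
Local Notation b i := (bweight sigma p i 0).
Local Notation tau := (\sum_i b i * q i).
Local Notation w := (fun i => (gexp sigma p - 1) * b i).
Context (ser : serial S) (hrho : rho <= 1).

(* The eigenpair provided by nonneg_eigenpair_exists, whose eigenvalue is
   approached by upper bounds. *)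
Context (lam : R) (u : blockvec R n) (l0 : 0 <= lam) (uK : Kp u) (eu : eigen S q lam (entry u)).
Context (approx : forall eps, 0 < eps -> exists x B, [/\ forall a, 0 < x a, normalized S q x,
      forall i, 0 < B i, forall a, Fq S q x a <= B (tag a) * x a &
      \prod_i B i `^ w i <= lam + eps]).

(** The comparison with the vectors whose upper numbers approach lam. *)
Lemma cw_bound (y : bindex n -> R) (alpha : 'I_d -> R) : (forall a, 0 <= y a) ->
  normalized S q y -> (forall i, 0 <= alpha i) ->
  (forall a, alpha (tag a) * y a <= Fq S q y a) ->
  \prod_i alpha i `^ w i <= lam.
Proof.
move=> y0 ny al0 ya; rewrite -lee_fin; apply/lee_addgt0Pr => eps eps0.
have [x [B [x0 nx B0 xB hB]]] := approx eps0.
have [c prw] := perron_w hm hN hT sigma hp.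
rewrite -EFinD lee_fin; apply: le_trans hB.
exact: (cw_le prw hrho x0 y0 nx ny).
Qed.

Lemma eigenvalue_le theta x : eigenpair sigma p T theta x -> `|theta| <= lam.
Proof.
move=> ex; have [na ha] := eigenpair_abs hN hT hp ex.
have [c [q0 w0 _ _ _]] := perron_w hm hN hT sigma hp.
rewrite -(prod_powR_eigenvalue q0 w0 (w_normalized hm sigma hp) (normr_ge0 theta)).
apply: (cw_bound _ na) ha; first exact: absv_Kp.
by move=> i; exact: powR_ge0.
Qed.

Lemma radiusE : lam%:E = tensor_radius sigma p T.
Proof.
apply/eqP; rewrite eq_le; apply/andP; split.
  apply: ereal_sup_ubound; exists lam; last by rewrite ger0_norm.
  by exists u; apply/(eigenpair_eigen hN hT hp).
apply: ge_ereal_sup => _ [th [x ex] <-].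
by rewrite lee_fin (eigenvalue_le ex).
Qed.

Lemma cw_lower_le y : Sp p y -> cw_lower sigma p F y <= lam.
Proof.
move=> ySp; have [al [al0 h ->]] := cw_lower_bound hN hT hp ySp.
by have /(SpP hN hT hp)[yK ny] := ySp; exact: cw_bound h.
Qed.

Lemma cw_upper_ge x : Spp p x -> lam <= cw_upper sigma p F x.
Proof.
move=> [/(SpP hN hT hp)[xK nx] /KppP x0].
have [B [B0 xB ->]] := cw_upper_bound p x0 ser.
have [c prw] := perron_w hm hN hT sigma hp; have [q0 w0 _ _ _] := prw.
rewrite -[leLHS](prod_powR_eigenvalue q0 w0 (w_normalized hm sigma hp) l0).
apply: (cw_le prw hrho x0 uK nx eu.2 B0 _ xB).
  by move=> i; exact: powR_ge0.
by move=> a; rewrite (eigen_Fq q0 l0 uK eu).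
Qed.

Lemma cw_upper_near eps : 0 < eps -> exists2 x, Spp p x & cw_upper sigma p F x <= lam + eps.
Proof.
move=> eps0; have [x [B [x0 nx B0 xB hB]]] := approx eps0.
have x0' a : 0 < entry (mkvec x) a by rewrite entry_mkvec.
exists (mkvec x); last first.
  apply: le_trans hB; apply: (cw_upper_le hm hp (hN := hN) (hT := hT)) => //.
  by move=> a; rewrite entry_mkvec.
split; last exact/KppP.
by apply/(SpP hN hT hp); rewrite entry_mkvec; split=> // a; rewrite entry_mkvec ltW.
Qed.

Lemma inf_cw_upper :
  ereal_inf [set (cw_upper sigma p F x)%:E | x in Spp p] = lam%:E.
Proof.
apply/eqP; rewrite eq_le; apply/andP; split; last first.
  by apply: le_ereal_inf_tmp => _ [x xS <-]; rewrite lee_fin cw_upper_ge.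
apply/lee_addgt0Pr => eps eps0; have [x xS hx] := cw_upper_near eps0.
apply: (@le_trans _ _ (cw_upper sigma p F x)%:E); last by rewrite -EFinD lee_fin.
by apply: ereal_inf_lbound; exists x.
Qed.

(** The constant depends on the vector only through an upper bound M of its
entries, as the limit of suprema over the sphere requires. *)
Lemma growth_bound (M : bindex n -> R) eps : rho = 1 -> 0 < eps ->
  exists2 C, 0 < C & forall z, Kp z -> (forall a, entry z a <= M a) -> forall k,
    wnorm sigma p (iter k F z) <= C * ((lam + eps) `^ tau) ^+ k.
Proof.
move=> rho1 eps0; have [x [B [x0 nx B0 xB hB]]] := approx eps0.
have [c] := perron_b hm hN hT sigma hp; rewrite rho1 => prb.
have [C C0 hC] := growth_upper M prb x0 nx B0 xB.
exists C => // z zK zM k.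
rewrite (wnorm_block hN hT hp (iter_Kp hN hT p k zK)) (entry_iter hN hT).
apply: le_trans (hC _ zK zM k) _; rewrite ler_pM2l //.
have t0 := tau_gt0 hm sigma hp.
apply: lerXn2r; rewrite ?nnegrE ?powR_ge0 //.
  by apply: prodr_ge0 => i _; exact: powR_ge0.
have -> : \prod_i B i `^ b i = (\prod_i B i `^ w i) `^ tau.
  rewrite !prod_powR // -expRM; congr expR.
  rewrite (gexpE hm sigma hp) mulr_suml; apply: eq_bigr => i _.
  by field; rewrite gt_eqF.
rewrite ge0_ler_powR ?nnegrE ?(ltW t0) //.
  by apply: prodr_ge0 => i _; exact: powR_ge0.
by rewrite addr_ge0 // ltW.
Qed.

Lemma growth_eigenvector k : rho = 1 -> (0 < k)%N ->
  (lam `^ tau) ^+ k <= wnorm sigma p (iter k F u).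
Proof.
move=> rho1 k0; have t0 := tau_gt0 hm sigma hp.
rewrite (wnorm_block hN hT hp (iter_Kp hN hT p k uK)) (entry_iter hN hT).
have [lz|lz] := eqVneq lam 0.
  rewrite lz powR0 ?gt_eqF // expr0n gtn_eqF //=.
  by apply: prodr_ge0 => i _; exact: powR_ge0.
have [c] := perron_b hm hN hT sigma hp; rewrite rho1 => prb.
by rewrite (growth_eigen k prb uK _ eu) // lt_def lz.
Qed.

Lemma wnorm_ge0 z : 0 <= wnorm sigma p z.
Proof. by apply: prodr_ge0 => i _; exact: powR_ge0. Qed.

Lemma eigenvector_Kp0 : Kp0 u.
Proof.
split=> // i; have [[k l] ki ul] := normalized_neq0 i (qexp_gt0 hp) uK eu.2.
rewrite /= in ki; subst k; apply/eqP => /rowP/(_ l); rewrite mxE => uz.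
by move: ul; rewrite /entry /= uz ltxx.
Qed.

Lemma eigenvector_Sp : Sp p u.
Proof. by apply/(SpP hN hT hp); split=> //; case: eu. Qed.

Lemma growth_limsup : rho = 1 ->
  lam%:E = ereal_sup [set limn_esup (fun k =>
     ((wnorm sigma p (iter k F z)) `^ ((gexp sigma p - 1) / k%:R))%:E) | z in Kp0].
Proof.
move=> rho1; have t0 := tau_gt0 hm sigma hp.
have ti0 : 0 < tau^-1 by rewrite invr_gt0.
rewrite (gexpE hm sigma hp).
apply/eqP; rewrite eq_le; apply/andP; split.
  apply: (@le_trans _ _ (limn_esup (fun k =>
      ((wnorm sigma p (iter k F u)) `^ (tau^-1 / k%:R))%:E))); last first.
    by apply: ereal_sup_ubound; exists u => //; exact: eigenvector_Kp0.
  apply: limn_esup_lb; exists 1%N => // k /= k0; rewrite lee_fin.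
  by apply: root_lower => //; rewrite invrK growth_eigenvector.
apply: ge_ereal_sup => _ [z [zK _] <-].
apply/lee_addgt0Pr => eps eps0; apply: limn_esup_ub.
have := @root_upper R lam tau^-1 eps (fun k => wnorm sigma p (iter k F z)) ti0 l0
  (fun k => wnorm_ge0 _) eps0.
rewrite invrK => h; apply: filterS (h _) => [k hk|e e0].
  by rewrite -EFinD lee_fin.
have [C C0 hC] := growth_bound (entry z) rho1 e0.
by exists C => // k; exact: hC.
Qed.

Lemma growth_limit : rho = 1 ->
  (fun k => poweR (ereal_sup [set (wnorm sigma p (iter k F z))%:E | z in Sp p])
     ((gexp sigma p - 1) / k%:R)) @ \oo --> lam%:E.
Proof.
move=> rho1; have t0 := tau_gt0 hm sigma hp.
have ti0 : 0 < tau^-1 by rewrite invr_gt0.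
rewrite (gexpE hm sigma hp).
pose Sk k := ereal_sup [set (wnorm sigma p (iter k F z))%:E | z in Sp p].
have bound e : 0 < e -> exists2 C, 0 < C & forall k,
    (Sk k <= (C * ((lam + e) `^ tau) ^+ k)%:E)%E.
  move=> e0; have [C C0 hC] := growth_bound (fun=> 1) rho1 e0.
  exists C => // k; apply: ge_ereal_sup => _ [z /(SpP hN hT hp)[zK nz] <-].
  rewrite lee_fin hC // => a.
  exact: (normalized_le1 a (qexp_gt0 hp) zK nz).
have lower k : (0 < k)%N -> (((lam `^ tau) ^+ k)%:E <= Sk k)%E.
  move=> k0; apply: (@le_trans _ _ (wnorm sigma p (iter k F u))%:E).
    by rewrite lee_fin growth_eigenvector.
  by apply: ereal_sup_ubound; exists u => //; exact: eigenvector_Sp.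
have Sk_ge0 k : (0 <= Sk k)%E.
  apply: (@le_trans _ _ (wnorm sigma p (iter k F u))%:E).
    by rewrite lee_fin wnorm_ge0.
  by apply: ereal_sup_ubound; exists u => //; exact: eigenvector_Sp.
have Sk_fin k : Sk k \is a fin_num.
  have [C _ /(_ k) h] := bound 1 ltr01.
  by rewrite ge0_fin_numE // (le_lt_trans h) // ltry.
pose s k := fine (Sk k).
have sE k : Sk k = (s k)%:E by rewrite /s fineK.
rewrite (_ : (fun k => _) = EFin \o (fun k => s k `^ (tau^-1 / k%:R))); last first.
  by apply/funext => k; rewrite -/(Sk k) sE poweR_EFin.
apply: cvg_EFin; first by near=> k.
apply/cvgrPdist_le => eps eps0.
have := @root_upper R lam tau^-1 eps s ti0 l0 _ eps0.
rewrite invrK => h.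
have {}h : \forall k \near \oo, s k `^ (tau^-1 / k%:R) <= lam + eps.
  apply: h => [k|e e0]; first by rewrite fine_ge0.
  have [C C0 hC] := bound e e0; exists C => // k.
  by rewrite -lee_fin -sE hC.
near=> k.
have k0 : (0 < k)%N by near: k; exists 1%N.
have h1 : s k `^ (tau^-1 / k%:R) <= lam + eps by near: k.
have h2 : lam <= s k `^ (tau^-1 / k%:R).
  by apply: root_lower => //; rewrite invrK -lee_fin -sE lower.
rewrite /= distrC ger0_norm ?subr_ge0 // lerBlDr addrC //.
Unshelve. all: by end_near. Qed.

End Radius.

(** * The Perron-Frobenius theorem *)

Theorem theorem3p2 (R : realType) (m : nat) (hm : (0 < m)%N)
    (N : 'I_m -> nat) (hN : forall j, (0 < N j)%N)
    (T : tensor R N) (hT : forall J, 0 <= T J)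
    (d : nat) (sigma : shape_partition N d)
    (p : 'I_d -> R) (hp : forall i, 1 < p i)
    (hsn : strictly_nonneg sigma T)
    (hrho : spectral_radius (Amatrix sigma p) <= 1) :
  let r := tensor_radius sigma p T in
  let F := Fmap sigma p T in
  let rhoA := spectral_radius (Amatrix sigma p) in
  let gamma := gexp sigma p in
  [/\ (* (i) *)
      exists lambda u,
        [/\ eigenpair sigma p T lambda u, 0 <= lambda, Kp0 u & lambda%:E = r],
      (* (ii) *)
      [/\ 1 < gamma,
          ereal_inf [set (cw_upper sigma p F x)%:E | x in Spp p] = r,
          (exists2 y, Sp p y & (cw_lower sigma p F y)%:E = r) /\
          (forall y, Sp p y -> ((cw_lower sigma p F y)%:E <= r)%E)
        & rhoA = 1 ->
          r = ereal_sup [set limn_esup (fun k =>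
                 ((wnorm sigma p (iter k F z)) `^ ((gamma - 1) / k%:R))%:E)
               | z in Kp0] /\
          (fun k => poweR (ereal_sup [set (wnorm sigma p (iter k F z))%:E | z in Sp p])
                      ((gamma - 1) / k%:R)) @ \oo --> r],
      (* (iii) *)
      (rhoA < 1 \/ weakly_irreducible sigma T) ->
        exists lambda u,
          [/\ eigenpair sigma p T lambda u, lambda%:E = r, Kpp u
            & forall theta x, eigenpair sigma p T theta x -> Kpp x -> x = u],
      (* (iv) *)
      weakly_irreducible sigma T ->
        forall theta x, eigenpair sigma p T theta x -> (Kp0 `\` Kpp) x ->
          (theta%:E < r)%E
    & (* (v) *)
      strongly_irreducible sigma T ->
        forall lambda u,
          eigenpair sigma p T lambda u -> 0 <= lambda -> Kp0 u -> lambda%:E = r ->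
          Kpp u /\
          (forall theta x, eigenpair sigma p T theta x -> Kp x -> x = u)].
Proof.
move=> r F rhoA gamma.
have ser := strictly_nonneg_serial hN hT hsn.
have [c prw] := perron_w hm hN hT sigma hp.
have [lam [u0 [l0 u0K eu approx upos]]] :=
  nonneg_eigenpair_exists prw hrho (w_normalized hm sigma hp) ser.
pose u := mkvec u0.
have uE : entry u = u0 by exact: entry_mkvec.
rewrite -uE in u0K eu upos.
have rE : lam%:E = r by exact: (radiusE hm hp hrho l0 u0K eu approx).
have uEig : eigenpair sigma p T lam u by apply/(eigenpair_eigen hN hT hp).
(* Stated for an arbitrary positive v, because the last claim concerns an
   eigenvector given in advance. *)
have unique v : (rhoA < 1 \/ irreducible_system (tensor_system hN hT sigma)) ->
    eigenpair sigma p T lam v -> Kpp v ->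
    forall theta x, eigenpair sigma p T theta x -> Kp x -> lam <= theta -> x = v.
  move=> hr ev /KppP v0 theta x ex xK lt.
  have vK : Kp v by move=> a; exact: ltW.
  apply: entry_inj; apply: (rigidity prw hrho ser hr v0 xK) lt.
    exact/(eigenpair_eigen hN hT hp).
  exact/(eigenpair_eigen hN hT hp).
(* For a positive eigenvector the comparison applies in both directions. *)
have positive_value theta x : eigenpair sigma p T theta x -> Kpp x -> theta = lam.
  move=> ex /KppP x0.
  have xK : Kp x by move=> a; exact: ltW.
  have ex' : eigen (tensor_system hN hT sigma) (qexp p) theta (entry x).
    exact/(eigenpair_eigen hN hT hp).
  have [a _] := bindex_surj hN sigma (Ordinal (d_gt0 hm sigma)).
  have t0 := eigen_gt0 ser (qexp_gt0 hp) x0 ex' a.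
  apply/eqP; rewrite eq_le; apply/andP; split.
    by rewrite -(gtr0_norm t0); exact: (eigenvalue_le hm hp hrho approx ex).
  have [q0 w0 _ _ _] := prw.
  rewrite -[leRHS](prod_powR_eigenvalue q0 w0 (w_normalized hm sigma hp) (ltW t0)).
  rewrite -[leLHS](prod_powR_eigenvalue q0 w0 (w_normalized hm sigma hp) l0).
  apply: (cw_le prw hrho x0 u0K ex'.2 eu.2).
  - by move=> i; exact: powR_gt0.
  - by move=> i; exact: powR_ge0.
  - by move=> a'; rewrite (eigen_Fq q0 (ltW t0) xK ex').
  - by move=> a'; rewrite (eigen_Fq q0 l0 u0K eu).
split.
- exists lam, u; split=> //; exact: (eigenvector_Kp0 hp u0K eu).
- split.
  + by rewrite -subr_gt0 (gexpE hm sigma hp) invr_gt0 tau_gt0.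
  + by rewrite -rE; exact: (inf_cw_upper hm hp ser hrho l0 u0K eu approx).
  + rewrite -rE; split.
      exists u; first exact: (eigenvector_Sp hp u0K eu).
      by rewrite (cw_lower_eigen hm hp u0K l0 eu).
    by move=> y yS; rewrite lee_fin; exact: (cw_lower_le hm hp hrho approx yS).
  + move=> rho1; rewrite -rE; split.
      exact: (growth_limsup hm hp l0 u0K eu approx rho1).
    exact: (growth_limit hm hp l0 u0K eu approx rho1).
- move=> wi; have hr : rhoA < 1 \/ irreducible_system (tensor_system hN hT sigma).
    by case: wi => [|/(weakly_irreducible_system hN hT)]; [left|right].
  have uP : Kpp u by apply/KppP/upos.
  exists lam, u; split=> // theta x ex xP.
  apply: (unique u hr uEig uP theta x) => //.
    by move/KppP: xP => x0 a; exact: ltW.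
  by rewrite (positive_value _ _ ex xP).
- move=> wi theta x ex [[xK xn] xP]; rewrite -rE lte_fin ltNge; apply/negP => lt.
  have uP : Kpp u.
    by apply/KppP/upos; right; exact: weakly_irreducible_system.
  by apply: xP; rewrite (unique u (or_intror (weakly_irreducible_system hN hT wi)) uEig uP theta x).
- move=> si lam' v ev l'0 vK0 l'r.
  have {l'r} ll : lam' = lam by apply: EFin_inj; rewrite l'r rE.
  subst lam'.
  have strP theta x : eigenpair sigma p T theta x -> Kp0 x -> Kpp x.
    move=> ex x0; apply: contrapT => xP; have [[i l] [xa ga]] := si x (conj x0 xP).
    by move: ga; rewrite (ex.1 i l) /psi [x i 0 l]xa sgr0 !mulr0 ltxx.
  have vP := strP _ _ ev vK0.
  split=> // theta x ex xK.
  have xK0 : Kp0 x.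
    split=> // i; have /(lpnorm_normalized hN hT hp xK) nx := ex.2.
    have [[k l] ki xl] := normalized_neq0 i (qexp_gt0 hp) xK nx.
    rewrite /= in ki; subst k; apply/eqP => /rowP/(_ l); rewrite mxE => xz.
    by move: xl; rewrite /entry /= xz ltxx.
  have xP := strP _ _ ex xK0.
  have irr : irreducible_system (tensor_system hN hT sigma).
    by apply: strong_irreducible => //; exact: strongly_irreducibleP.
  apply: (unique v (or_intror irr) ev vP theta x ex xK).
  by rewrite (positive_value _ _ ex xP).
Qed.
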